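(* Let $H$ be a finite connected graph on $v\ge2$ labeled vertices which is not a tree, let $\widetilde\Delta$ be the maximum degree of its $2$-core $\widetilde H$, let $\phi:[c]^v\to\mathbb R$ be an arbitrary function, and let $\mathcal G_n$ be the Erdős–Rényi random graph on $[n]$ with edge probability $p_n$, where $$(n\log n)^{-1/\widetilde\Delta}\ll p_n\ll1.$$ Then the following hold. (i) Let $\mathbf X=(X_1,\ldots,X_n)$ with $X_i$ i.i.d. from $\mu$, independent of $\mathcal G_n$. Then $N_n(\mathrm{Sym}[\mathcal G_n],\phi,\mathbf X)$ satisfies a conditional LDP (conditionally on $\mathrm{Sym}[\mathcal G_n]$) with speed $n$ and the good rate function $$J_{\mathbb 1}(t)=\inf_{\boldsymbol f\in\mathcal F_c:\ G_{\mathbb 1,\phi}(\boldsymbol f)=t}\left\{\int_0^1\sum_{r=1}^c f_r(u)\log\frac{f_r(u)}{\mu_r}\,du\right\},$$ where $\mathbb 1$ denotes the function identically equal to $1$ on $[0,1]^v$. (ii) For any $\beta\in\mathbb R$, $$Z_{\mathrm{Sym}[\mathcal G_n]}(\beta,\mu)\xrightarrow[n\to\infty]{\mathbb P}\sup_{\boldsymbol f\in\mathcal F_c}\left\{\beta\,G_{\mathbb 1,\phi}(\boldsymbol f)-\int_0^1\sum_{r=1}^c f_r(u)\log\frac{f_r(u)}{\mu_r}\,du\right\}.$$ Moreover, the supremum on the right-hand side is attained.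
   Context: An integer $c\ge2$ is fixed, $[m]:=\{1,\ldots,m\}$, and $\mu$ is a probability measure on $[c]$ with $\mu_r:=\mu(\{r\})>0$ for all $r\in[c]$. Notation $a_n\ll b_n$ means $a_n/b_n\to0$. $H=(V(H),E(H))$ has vertex set $[v]$ and $e:=|E(H)|$ edges. Its $2$-core $\widetilde H$ is the maximal subgraph of $H$ in which all vertices have degree at least $2$ (obtained by repeatedly deleting leaves; nonempty since $H$ is not a tree). The random graph $\mathcal G_n$ is given by $\mathcal G_n(i,j)\sim\mathrm{Ber}(p_n)$ independently for $i<j$, $\mathcal G_n(i,j)=\mathcal G_n(j,i)$ for $i>j$, $\mathcal G_n(i,i)=0$. Define the symmetric zero-diagonal tensor $$\mathrm{Sym}[\mathcal G_n](i_1,\ldots,i_v):=\frac1{v!\,p_n^e}\sum_{\sigma\in S_v}\prod_{\{a,b\}\in E(H)}\mathcal G_n(i_{\sigma(a)},i_{\sigma(b)})\,\mathbf 1_{\{i_1,\ldots,i_v\text{ all distinct}\}}.$$ For a tensor $Q_n:[n]^v\to\mathbb R$, $$N_n(Q_n,\phi,\mathbf X):=\frac1{n^v}\sum_{i_1,\ldots,i_v=1}^n Q_n(i_1,\ldots,i_v)\,\phi(X_{i_1},\ldots,X_{i_v}),\qquad Z_{Q_n}(\beta,\mu):=\frac1n\log\mathbb E_{\mu^{\otimes n}}\exp\big(n\beta N_n(Q_n,\phi,\mathbf X)\big),$$ where in $Z$ the expectation is over $\mathbf X\sim\mu^{\otimes n}$ only, with $Q_n$ held fixed. $\mathcal F_c$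 is the set of measurable $\boldsymbol f=(f_1,\ldots,f_c):[0,1]\to[0,1]^c$ with $\sum_{r=1}^c f_r(x)=1$ for all $x$ (modulo a.e. equality), and for symmetric $W\in L^1([0,1]^v)$, $$G_{W,\phi}(\boldsymbol f):=\int_{[0,1]^v}W(x_1,\ldots,x_v)\sum_{r_1,\ldots,r_v\in[c]}\phi(r_1,\ldots,r_v)\prod_{a=1}^v f_{r_a}(x_a)\,dx_1\cdots dx_v.$$ Conditional LDP: for random tensors $Q_n$, $N_n(Q_n,\phi,\mathbf X)$ satisfies a conditional LDP with speed $n$ and deterministic good rate function $J:\mathbb R\to[0,\infty]$ if the level sets of $J$ are compact and, for every Borel set $F\subseteq\mathbb R$ and every $\varepsilon>0$, $$\mathbb P_{Q_n}\left(-\inf_{x\in F^\circ}J(x)-\varepsilon\le\frac1n\log\mathbb P\big(N_n(Q_n,\phi,\mathbf X)\in F\mid Q_n\big)\le-\inf_{x\in\overline F}J(x)+\varepsilon\right)\xrightarrow{n\to\infty}1,$$ where $\mathbb P_{Q_n}$ is the probability over the randomness of $Q_n$. Conventions: $0\log0=0$, $\inf\emptyset=+\infty$. *)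

(* Defs.v *)
From HB Require Import structures.
From mathcomp Require Import all_boot all_order all_algebra all_fingroup.
From mathcomp Require Import all_classical all_reals all_analysis.

Set Implicit Arguments.
Unset Strict Implicit.
Unset Printing Implicit Defensive.

Import Order.TTheory GRing.Theory Num.Theory.
Import numFieldNormedType.Exports.

Local Open Scope classical_set_scope.
Local Open Scope ring_scope.

Section graphs.
Variables (T : finType) (adj : rel T).

Definition simple_graph := symmetric adj /\ irreflexive adj.

Definition connected_graph := forall x y : T, connect adj x y.

Definition acyclic_graph :=
  forall s : seq T, ucycle adj s -> (size s <= 2)%N.

Definition is_tree := connected_graph /\ acyclic_graph.

(* A subgraph is given by its vertex set S and its adjacency relation F. *)
Definition is_subgraph (S : {set T}) (F : rel T) :=
  symmetric F /\ forall x y, F x y -> [/\ adj x y, x \in S & y \in S].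

Definition degree (F : rel T) (x : T) : nat := #|[set y | F x y]|.

Definition min_degree2 (S : {set T}) (F : rel T) :=
  forall x, x \in S -> (2 <= degree F x)%N.

Definition induced (S : {set T}) : rel T :=
  fun x y => [&& x \in S, y \in S & adj x y].

(* The 2-core is the largest subgraph of minimum degree at least 2: it is
   induced, on the union of the vertex sets that induce minimum degree at
   least 2 (see [two_core_is_subgraph], [two_core_min_degree2] and
   [two_core_max]). *)
Definition two_core_vert : {set T} :=
  (\bigcup_(S : {set T} |
     [forall x in S, (2 <= degree (induced S) x)%N]) S)%SET.

Definition two_core_adj : rel T := induced two_core_vert.

Definition two_core_max_degree : nat :=
  (\max_(x in two_core_vert) degree two_core_adj x)%N.

Lemma two_core_is_subgraph :
  symmetric adj -> is_subgraph two_core_vert two_core_adj.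
Proof.
move=> sadj; split=> [x y|x y /and3P[]//].
by rewrite /two_core_adj /induced sadj andbCA.
Qed.

Lemma degree_sub (F F' : rel T) x :
  (forall y, F x y -> F' x y) -> (degree F x <= degree F' x)%N.
Proof.
by move=> FF'; apply/subset_leq_card/fintype.subsetP => y; rewrite !inE => /FF'.
Qed.

Lemma two_core_min_degree2 : min_degree2 two_core_vert two_core_adj.
Proof.
move=> x /finset.bigcupP[S S2 xS].
have /forall_inP/(_ x xS) /leq_trans := S2; apply.
apply: degree_sub => y /and3P[_ yS xy]; apply/and3P; split=> //.
- by apply/finset.bigcupP; exists S.
- by apply/finset.bigcupP; exists S.
Qed.

Lemma two_core_max (S : {set T}) (F : rel T) :
  is_subgraph S F -> min_degree2 S F ->
  (S \subset two_core_vert) /\ subrel F two_core_adj.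
Proof.
move=> [_ SF] F2.
have sub : S \subset two_core_vert.
  apply: (@finset.bigcup_sup _ _ S) => //; apply/forall_inP => x xS.
  apply: leq_trans (F2 x xS) _; apply: degree_sub => y /SF[xy _ yS].
  by rewrite /induced xS yS.
split=> // x y /SF[xy xS yS]; rewrite /two_core_adj /induced xy.
by rewrite !(fintype.subsetP sub).
Qed.

End graphs.

(* Each edge {a, b} is listed once, as the pair with a < b. *)
Definition edges (v : nat) (adj : rel 'I_v) : {set 'I_v * 'I_v} :=
  [set ab : 'I_v * 'I_v | (ab.1 < ab.2)%N && adj ab.1 ab.2]%SET.

(* The set [c]. Measurable types are pointed, hence the .-1.+1: color c is
   'I_c when 0 < c. *)

Definition color (c : nat) := 'I_c.-1.+1.
HB.instance Definition _ c := Finite.on (color c).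
HB.instance Definition _ c := isPointed.Build (color c) ord0.
HB.instance Definition _ c := @isMeasurable.Build default_measure_display
  (color c) discrete_measurable discrete_measurable0
  discrete_measurableC discrete_measurableU.

Section product_probability.
Context d (T : measurableType d) (R : realType) (P : probability T R).

Definition cons_pair n (x : T * n.-tuple T) : n.+1.-tuple T :=
  [tuple of x.1 :: x.2].

Lemma measurable_cons_pair n : measurable_fun setT (@cons_pair n).
Proof. exact: measurable_cons measurable_fst measurable_snd. Qed.

HB.instance Definition _ n :=
  isMeasurableFun.Build _ _ _ _ (@cons_pair n) (@measurable_cons_pair n).

Fixpoint tuple_prob (n : nat) : probability (n.-tuple T) R :=
  if n is m.+1 then distribution (P \x tuple_prob m)%E (@cons_pair m)
  else \d_([tuple]).

Lemma tuple_probE n (A : 'I_n -> set T) : (forall i, measurable (A i)) ->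
  tuple_prob n [set t | forall i, A i (tnth t i)] =
  (\prod_(i < n) P (A i))%E.
Proof.
elim: n A => [|n IH] A mA.
  by rewrite big_ord0 /= diracE mem_set // => -[].
rewrite big_ord_recl -IH // /= /distribution /pushforward.
rewrite -product_measure1E //; last first.
  rewrite (_ : [set t | _] = \bigcap_(i in [set: 'I_n])
    ((fun t : n.-tuple T => tnth t i) @^-1` A (lift ord0 i))).
    apply: fin_bigcap_measurable => // i _; rewrite -[X in measurable X]setTI.
    exact: measurable_tnth.
  by apply/seteqP; split=> t /= h i => [_|]; apply: h.
congr (_ _); apply/seteqP; split=> -[x t] /=.
  move=> h; split; first by have := h ord0.
  by move=> i; have := h (lift ord0 i); rewrite tnthS.
move=> [hx ht] i; have [->//|i0] := eqVneq i ord0.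
have [j ->] : exists j, i = lift ord0 j.
  by case: (unliftP ord0 i) i0 => [j ->|->]; [exists j|rewrite eqxx].
by rewrite tnthS; apply: ht.
Qed.

End product_probability.

Section independence.
Context d (Omega : measurableType d) (R : realType) (P : probability Omega R).

Definition mutually_independent (I : finType) (D : {set I})
    d' (T : measurableType d') (X : I -> Omega -> T) :=
  forall (J : {set I}) (A : I -> set T), J \subset D ->
    (forall i, measurable (A i)) ->
    P (\bigcap_(i in [set` J]) X i @^-1` A i) =
    (\prod_(i in J) P (X i @^-1` A i))%E.

(* To be used for random elements taking finitely many values, for which all
   sets of values are measurable. *)
Definition independent_finite (S S' : Type) (Y : Omega -> S) (Z : Omega -> S')
    :=
  forall (B : set S) (C : set S'),
    P (Y @^-1` B `&` Z @^-1` C) = (P (Y @^-1` B) * P (Z @^-1` C))%E.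

(* P(A | Y), a function of the sample point, for Y taking finitely many
   values. *)
Definition cond_prob (S : Type) (A : set Omega) (Y : Omega -> S) (w : Omega)
    : R :=
  fine (P (A `&` [set w' | Y w' = Y w])) / fine (P [set w' | Y w' = Y w]).

End independence.

Section asymptotics.
Context (R : realType).

(* a_n << b_n; division is total, so that the quotient being defined has to
   be required. *)
Definition much_less (a b : nat -> R) :=
  (\forall n \near \oo, b n != 0) /\ a n / b n @[n --> \oo] --> 0.

(* Convergence in probability to a constant; the n-th variable is defined on
   the n-th probability space. *)
Definition cvg_in_prob (d : nat -> measure_display)
    (Omega : forall n, measurableType (d n))
    (P : forall n, probability (Omega n) R)
    (Z : forall n, Omega n -> R) (l : \bar R) :=
  forall eps : R, 0 < eps ->
    P n [set w | (eps%:E < `|(Z n w)%:E - l|)%E] @[n --> \oo] --> 0%E.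

(* The speed is n; Q n has to take finitely many values, see cond_prob. *)
Definition conditional_LDP (d : nat -> measure_display)
    (Omega : forall n, measurableType (d n))
    (P : forall n, probability (Omega n) R)
    (S : nat -> Type) (Q : forall n, Omega n -> S n)
    (N : forall n, Omega n -> R) (J : R -> \bar R) :=
  [/\ forall t, (0 <= J t)%E,
      forall a : R, compact [set t | (J t <= a%:E)%E] &
      forall (F : set R) (eps : R), measurable F -> 0 < eps ->
        P n [set w |
          let logp :=
            ((n%:R^-1)%:E * lne (cond_prob (P n) (N n @^-1` F) (Q n) w)%:E)%E in
          (- ereal_inf (J @` F°) - eps%:E <= logp)%E /\
          (logp <= - ereal_inf (J @` closure F) + eps%:E)%E]
        @[n --> \oo] --> 1%E].

End asymptotics.

Section random_graph.
Context (R : realType) d (Omega : measurableType d) (P : probability Omega R).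

Definition erdos_renyi (n : nat) (p : R) (G : 'I_n -> 'I_n -> {RV P >-> bool})
    :=
  [/\ forall (i j : 'I_n), (i < j)%N ->
        forall B, distribution P (G i j) B = bernoulli_prob p B,
      mutually_independent P [set ij : 'I_n * 'I_n | (ij.1 < ij.2)%N]%SET
        (fun ij => G ij.1 ij.2),
      forall (i j : 'I_n) w, G i j w = G j i w &
      forall (i : 'I_n) w, G i i w = false].

End random_graph.

Section functionals.
Context (R : realType) (v c : nat).

Definition sym_tensor (adj : rel 'I_v) (n : nat) (p : R) (g : 'I_n -> 'I_n -> bool)
    (i : v.-tuple 'I_n) : R :=
  ((v`!)%:R * p ^+ #|edges adj|)^-1 *
  \sum_(s : 'S_v)
    (\prod_(ab in edges adj) (g (tnth i (s ab.1)) (tnth i (s ab.2)))%:R) *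
    (uniq i)%:R.

Definition Nstat (n : nat) (Q : v.-tuple 'I_n -> R)
    (phi : v.-tuple (color c) -> R) (x : n.-tuple (color c)) : R :=
  (n%:R ^+ v)^-1 *
  \sum_(i : v.-tuple 'I_n) Q i * phi [tuple tnth x (tnth i a) | a < v].

Definition Zpart (n : nat) (Q : v.-tuple 'I_n -> R)
    (phi : v.-tuple (color c) -> R) (beta : R) (mu : probability (color c) R)
    : R :=
  n%:R^-1 *
  ln (fine ('E_(tuple_prob mu n)[fun x => expR (n%:R * beta * Nstat Q phi x)])).

(* F_c, without the quotient by almost everywhere equality: the functionals
   below do not distinguish almost everywhere equal functions. *)
Definition Fc : set (color c -> R -> R) :=
  [set f : color c -> R -> R |
          [/\ forall r, measurable_fun (`[0, 1] : set R) (f r),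
               forall r (x : R), x \in `[0, 1] -> f r x \in `[0, 1] &
               forall x : R, x \in `[0, 1] -> \sum_r f r x = 1]].

Definition cube : set (v.-tuple (measurableTypeR R)) :=
  [set x | forall a, (tnth x a : R) \in `[0, 1]].

(* Lebesgue measure on [0, 1]^v: uniform_prob is Lebesgue measure restricted
   to [0, 1]. *)
Definition cube_measure : probability (v.-tuple (measurableTypeR R)) R :=
  tuple_prob (uniform_prob (@ltr01 R)) v.

Definition Gfun (W : v.-tuple R -> R) (phi : v.-tuple (color c) -> R)
    (f : color c -> R -> R) : R :=
  \int[cube_measure]_(x in cube)
    (W x * \sum_(r : v.-tuple (color c))
             phi r * \prod_(a < v) f (tnth r a) (tnth x a)).

(* ln 0 = 0 in the library, so that 0 log 0 = 0. *)
Definition entropy (mu : probability (color c) R) (f : color c -> R -> R) : R :=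
  \int[lebesgue_measure]_(u in `[0, 1])
    \sum_r f r u * ln (f r u / fine (mu [set r])).

Definition Jrate (W : v.-tuple R -> R) (phi : v.-tuple (color c) -> R)
    (mu : probability (color c) R) (t : R) : \bar R :=
  ereal_inf [set (entropy mu f)%:E | f in [set f | Fc f /\ Gfun W phi f = t]].

Definition Zobjective (W : v.-tuple R -> R) (phi : v.-tuple (color c) -> R)
    (mu : probability (color c) R) (beta : R) (f : color c -> R -> R) : R :=
  beta * Gfun W phi f - entropy mu f.

Definition Zlimit (W : v.-tuple R -> R) (phi : v.-tuple (color c) -> R)
    (mu : probability (color c) R) (beta : R) : \bar R :=
  ereal_sup [set (Zobjective W phi mu beta f)%:E | f in Fc].

End functionals.

(* Main.v *)
(* The tensor Sym[G_n] is uniformly close to the constant 1: with high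
   probability, N(Sym[G_n], phi, x) differs by o(1) from N(1, phi, x) for all
   colourings x simultaneously.

   For a nonnegative weight on the copies of H, Janson's inequality bounds the
   lower tail of the weighted count by exp(-t^2 / 2D), where D is the sum of the
   means of products of overlapping copies.  Deleting vertices of degree at most
   1 from a set F of at least two vertices ends either with two vertices or
   inside the 2-core, where e(F) <= |F| Delta / 2; so the lower bound on p_n
   gives n^|F| p_n^e(F) >> n, hence D << (n^v p_n^e)^2 / n.  The lower tail is thus
   exp(-omega(n)), which survives a union bound over the c^n colourings.  Upper
   tails are not that small, but they are not needed: the counts weighted by
   K + phi and K - phi add up to 2K times the total number of copies, which
   concentrates by Chebyshev's inequality, so two lower bounds give two-sided
   control.

   N(1, phi, x) is a polynomial in the empirical measure of x, so the theorem
   becomes Sanov's theorem and Varadhan's lemma for the empirical measure of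
   i.i.d. colours: upper bounds by counting types, lower bounds by tilting.  By
   convexity of s log s the variational problems over F_c are attained at
   constant functions, i.e. at points of the simplex, which is compact. *)
Require Import Defs.
From HB Require Import structures.
From mathcomp Require Import all_boot all_order all_algebra all_fingroup.
From mathcomp Require Import all_classical all_reals all_analysis.
From mathcomp Require Import measurable_realfun ring lra zify.

Set Implicit Arguments.
Unset Strict Implicit.
Unset Printing Implicit Defensive.

Import Order.TTheory GRing.Theory Num.Theory.
Import numFieldNormedType.Exports.

Local Open Scope classical_set_scope.
Local Open Scope ring_scope.

(** * Product Bernoulli measures *)

(** Inside the core, the lower bound on p_n only yields (n^|F| p^e(F))^2 >= (n^2 p^Delta)^|F| >= (n
    / log n)^|F|. For |F| = 2 this would be n / log n, short of the large multiple of n that the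
    union bound requires. But minimum degree 2 in a simple graph forces |F| >= 3, and (n / log
    n)^(3/2) exceeds every multiple of n. Working with squares avoids half-integer exponents.

    The comparison with N(1, phi, x) concerns finitely many bits, so graphs are encoded as Boolean
    functions on pairs and their expectations are finite weighted sums; measure theory enters only
    through the law of this code. Once the tensor is frozen, the asymptotics of the colours are
    deterministic and uniform over all tensors whose statistics are close to N(1, phi, x), so the
    graph matters only through one event of small probability. *)

Section bernoulli_product.
Context {R : realType} {I : finType}.
Implicit Types (q : I -> R) (g : {ffun I -> bool}) (h u : {ffun I -> bool} -> R).

Definition bern_weight q g : R := \prod_i (if g i then q i else 1 - q i).

Definition bern_mean q h : R := \sum_g bern_weight q g * h g.

Definition update g i b : {ffun I -> bool} :=
  [ffun j => if j == i then b else g j].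

(** The conditional expectation of [h] given all coordinates except [i]. Iterating it along a list
    of coordinates reduces statements on the product law to statements on one bit. *)
Definition resample q i h g : R :=
  q i * h (update g i true) + (1 - q i) * h (update g i false).

Definition decreasing h := forall g g', (forall i, g i -> g' i) -> h g' <= h g.

Definition depends_outside (S : {set I}) h :=
  forall g g', (forall i, i \notin S -> g i = g' i) -> h g = h g'.

Lemma bern_weight_ge0 q g : (forall i, 0 <= q i <= 1) -> 0 <= bern_weight q g.
Proof.
by move=> q01; apply: prodr_ge0 => i _; case: ifP => _; case/andP: (q01 i); lra.
Qed.

Lemma bern_mean1 q : bern_mean q (fun=> 1) = 1.
Proof.
rewrite /bern_mean; under eq_bigr do rewrite mulr1.
rewrite /bern_weight -(bigA_distr_bigA (fun i (b : bool) => if b then q i else 1 - q i)).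
by rewrite big1 // => i _; rewrite big_bool/=; ring.
Qed.

Lemma bern_mean_le q h u : (forall i, 0 <= q i <= 1) ->
  (forall g, h g <= u g) -> bern_mean q h <= bern_mean q u.
Proof.
by move=> q01 hu; apply: ler_sum => g _; rewrite ler_wpM2l// bern_weight_ge0.
Qed.

Lemma bern_meanZ q (k : R) h : bern_mean q (fun g => k * h g) = k * bern_mean q h.
Proof. by rewrite /bern_mean mulr_sumr; apply: eq_bigr => g _; ring. Qed.

Lemma bern_meanD q h u :
  bern_mean q (fun g => h g + u g) = bern_mean q h + bern_mean q u.
Proof. by rewrite /bern_mean -big_split; apply: eq_bigr => g _ /=; ring. Qed.

Lemma bern_mean_sum q (A : finType) (P : pred A) (F : A -> {ffun I -> bool} -> R) :
  bern_mean q (fun g => \sum_(a | P a) F a g) = \sum_(a | P a) bern_mean q (F a).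
Proof.
rewrite /bern_mean; under eq_bigr do rewrite mulr_sumr.
by rewrite exchange_big.
Qed.

Lemma eq_bern_mean q h u : (forall g, h g = u g) -> bern_mean q h = bern_mean q u.
Proof. by move=> e; apply: eq_bigr => g _; rewrite e. Qed.

(** Flipping bit [i] is an involution that exchanges the factors [q i] and [1 - q i] of the weight;
    reindexing half of the sum by it recovers the mean. *)
Lemma bern_mean_resample q i h : bern_mean q (resample q i h) = bern_mean q h.
Proof.
pose bw (b : bool) := if b then q i else 1 - q i.
pose fl g := update g i (~~ g i).
have flK : involutive fl.
  move=> g; apply/ffunP => j; rewrite !ffunE eqxx.
  by case: eqP => [->|//]; rewrite negbK.
have resE g : resample q i h g = bw (g i) * h g + bw (~~ g i) * h (fl g).
  have uE : update g i (g i) = g.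
    by apply/ffunP => j; rewrite !ffunE; case: eqP => [->|].
  rewrite /resample /fl /bw; case: (g i) uE => -> /=; ring.
have wE g : bern_weight q (fl g) * bw (g i) = bern_weight q g * bw (~~ g i).
  rewrite /bern_weight (bigD1 i)//= [X in _ = X * _](bigD1 i)//=.
  rewrite !ffunE eqxx -/(bw _) -/(bw _).
  rewrite [X in bw _ * X * _](eq_bigr (fun j => if g j then q j else 1 - q j)).
    by ring.
  by move=> j /negPf ji; rewrite ffunE ji.
rewrite /bern_mean; under eq_bigr do rewrite resE mulrDr.
rewrite big_split/= [X in _ + X](reindex_inj (inv_inj flK))/=.
rewrite -big_split/=; apply: eq_bigr => g _.
rewrite flK ffunE eqxx negbK !mulrA wE.
suff : bw (g i) + bw (~~ g i) = 1.
  by move=> bwE; rewrite -mulrDl -mulrDr bwE mulr1.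
by rewrite /bw; case: (g i) => /=; ring.
Qed.

Lemma bern_mean_foldr q l h : bern_mean q (foldr (resample q) h l) = bern_mean q h.
Proof. by elim: l => //= i l IH; rewrite bern_mean_resample. Qed.

Lemma foldr_resample_outside q l h g g' :
  (forall i, i \notin l -> g i = g' i) ->
  foldr (resample q) h l g = foldr (resample q) h l g'.
Proof.
elim: l g g' => [|i l IH] g g' gg' /=.
  by congr h; apply/ffunP => i; apply: gg'.
rewrite /resample; congr (_ * _ + _ * _); apply: IH => j jl; rewrite !ffunE;
  by case: eqP => // /eqP ji; apply: gg'; rewrite inE negb_or ji.
Qed.

(* Resampling every coordinate leaves the constant function equal to the mean. *)
Lemma bern_meanE q h g : bern_mean q h = foldr (resample q) h (enum I) g.
Proof.
rewrite -(bern_mean_foldr q (enum I)).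
rewrite (@eq_bern_mean _ _ (fun=> foldr (resample q) h (enum I) g * 1)).
  by rewrite bern_meanZ bern_mean1 mulr1.
move=> g'; rewrite mulr1; apply: foldr_resample_outside => i.
by rewrite mem_enum.
Qed.

Lemma decreasing_foldr q l h : (forall i, 0 <= q i <= 1) ->
  decreasing h -> decreasing (foldr (resample q) h l).
Proof.
move=> q01 hd; elim: l => //= i l IH g g' gg'.
have up b j : update g i b j -> update g' i b j.
  by rewrite !ffunE; case: eqP => // _; apply: gg'.
have /andP[q0 q1] := q01 i.
by apply: lerD; rewrite ler_wpM2l ?subr_ge0//; apply: IH => j; apply: up.
Qed.

(** Induction on the coordinates already resampled. For one bit the covariance is [q i * (1 - q i)]
    times the product of the two increments, which have the same sign because resampling preserves
    monotonicity. *)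
Lemma harris q h u : (forall i, 0 <= q i <= 1) -> decreasing h -> decreasing u ->
  bern_mean q h * bern_mean q u <= bern_mean q (fun g => h g * u g).
Proof.
move=> q01 hd ud; pose g0 : {ffun I -> bool} := [ffun=> false].
rewrite !(bern_meanE _ _ g0); elim: (enum I) g0 => //= i l IH g0.
rewrite [leRHS]/resample; have /andP[q0 q1] := q01 i.
apply: (@le_trans _ _
  (q i * (foldr (resample q) h l (update g0 i true) *
          foldr (resample q) u l (update g0 i true)) +
   (1 - q i) * (foldr (resample q) h l (update g0 i false) *
          foldr (resample q) u l (update g0 i false)))); last first.
  by apply: lerD; rewrite ler_wpM2l ?subr_ge0// ; apply: IH.
have up j : update g0 i false j -> update g0 i true j.
  by rewrite !ffunE; case: eqP.
have := decreasing_foldr l q01 hd up.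
have := decreasing_foldr l q01 ud up.
rewrite /resample -subr_ge0 => uu; rewrite -subr_ge0 => hh; rewrite -subr_ge0.
have : 0 <= q i * (1 - q i) by rewrite mulr_ge0// subr_ge0.
move=> /mulr_ge0 /(_ (mulr_ge0 hh uu)); congr (_ <= _); ring.
Qed.

Lemma depends_outside_foldr q l S h :
  depends_outside S h -> depends_outside S (foldr (resample q) h l).
Proof.
move=> hS; elim: l => //= i l IH g g' gg'; rewrite /resample.
by congr (_ * _ + _ * _); apply: IH => j jS; rewrite !ffunE;
  case: eqP => // _; apply: gg'.
Qed.

(** Resampling a bit that [h] does not read changes nothing, whatever its probability. This removes
    the conditioning from the copies disjoint from a given one. *)
Lemma bern_mean_outside q q' (S : {set I}) h : depends_outside S h ->
  (forall i, i \notin S -> q i = q' i) -> bern_mean q h = bern_mean q' h.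
Proof.
move=> hS qq'; pose g0 : {ffun I -> bool} := [ffun=> false].
rewrite !(bern_meanE _ _ g0); elim: (enum I) g0 => //= i l IH g0.
rewrite /resample !IH; have [iS|/qq' -> //] := boolP (i \in S).
have E b : foldr (resample q') h l (update g0 i b) = foldr (resample q') h l g0.
  apply: (depends_outside_foldr q' l hS) => j jS; rewrite ffunE; case: eqP => // ji.
  by rewrite ji iS in jS.
by rewrite !E; ring.
Qed.

Definition all_on (S : {set I}) g : R := \prod_(i in S) (g i)%:R.

Definition force (S : {set I}) q i := if i \in S then 1 else q i.

Lemma all_on_ge0 S g : 0 <= all_on S g.
Proof. by apply: prodr_ge0. Qed.

Lemma all_onU S T g : all_on S g * all_on T g = all_on (S :|: T)%SET g.
Proof.
rewrite /all_on ![\prod_(i in _) _]big_mkcond -big_split; apply: eq_bigr => i _ /=.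
by rewrite inE; case: (i \in S); case: (i \in T); case: (g i); rewrite /= ?mulr0 ?mulr1.
Qed.

Lemma all_on_mono S g g' : (forall i, g i -> g' i) -> all_on S g <= all_on S g'.
Proof.
move=> gg'; apply: ler_prod => i _; rewrite ler0n/=.
by have := gg' i; case: (g i) => [/(_ isT) ->//|]; case: (g' i).
Qed.

(** Conditioning on the bits of [S] being true, without a division: [force S q] is the conditional
    law, and the identity holds weight by weight even when the event has probability 0. *)
Lemma bern_mean_all_on q S h : bern_mean q (fun g => all_on S g * h g) =
  (\prod_(i in S) q i) * bern_mean (force S q) h.
Proof.
rewrite /bern_mean mulr_sumr; apply: eq_bigr => g _; rewrite !mulrA; congr (_ * _).
rewrite /all_on /bern_weight /force ![\prod_(i in _) _]big_mkcond -!big_split.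
apply: eq_bigr => i _ /=.
by case: (i \in S); case: (g i); rewrite ?mulr1 ?mul1r ?subrr ?mulr0.
Qed.

Lemma bern_mean_all_on1 q S : bern_mean q (all_on S) = \prod_(i in S) q i.
Proof.
have := bern_mean_all_on q S (fun=> 1); rewrite bern_mean1 mulr1 => <-.
by apply: eq_bern_mean => g; rewrite mulr1.
Qed.

End bernoulli_product.

(** * Janson's inequality *)

Lemma is_derive_bigsum (R : realType) (T : Type) (l : seq T)
    (F : T -> R -> R) (dF : T -> R) (x : R) :
  (forall i, is_derive x 1 (F i) (dF i)) ->
  is_derive x 1 (fun s => \sum_(i <- l) F i s) (\sum_(i <- l) dF i).
Proof.
move=> FdF; elim: l => [|i l IH].
  rewrite (_ : (fun _ => _) = cst 0); last by apply/funext => s; rewrite big_nil.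
  by rewrite big_nil; exact: is_derive_cst.
rewrite (_ : (fun _ => _) = F i \+ (fun s => \sum_(i <- l) F i s)); last first.
  by apply/funext => s; rewrite big_cons.
by rewrite big_cons; exact: is_deriveD.
Qed.

Section janson.
Context {R : realType} {I A : finType}.
Variables (q : I -> R) (S : A -> {set I}) (w : A -> R).
Hypothesis q01 : forall i, 0 <= q i <= 1.
Hypothesis w0 : forall a, 0 <= w a.

Definition weighted_count (g : {ffun I -> bool}) : R :=
  \sum_a w a * all_on (S a) g.

Definition count_mean : R := \sum_a w a * \prod_(i in S a) q i.

(** Ordered pairs, including [a = b] as soon as [S a] is nonempty. The same quantity controls the
    exponent in Janson's inequality and the variance in Chebyshev's. *)
Definition overlap_mean : R :=
  \sum_a \sum_(b | ~~ [disjoint S a & S b]%B)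
     w a * w b * \prod_(i in (S a :|: S b)%SET) q i.

Lemma all_on_outside (T T' : {set I}) : [disjoint T & T']%B ->
  depends_outside T (@all_on R _ T').
Proof.
move=> TT' g g' gg'; apply: eq_bigr => i iT'; congr (_%:R); rewrite gg'//.
by apply/negP => iT; move/pred0P: TT' => /(_ i)/=; rewrite iT iT'.
Qed.

Lemma decreasing_expR (s : R) (P : pred A) : 0 <= s ->
  decreasing (fun g => expR (- s * \sum_(b | P b) w b * all_on (S b) g)).
Proof.
move=> s0 g g' gg'; rewrite ler_expR !mulNr lerN2 ler_wpM2l//.
by apply: ler_sum => b _; rewrite ler_wpM2l// all_on_mono.
Qed.

(* Given all_on (S a), the copies meeting S a and those disjoint from S a have
   decreasing exponentials, and the latter do not feel the conditioning. *)
Lemma harris_on (s : R) (a : A) : 0 <= s ->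
  (\prod_(i in S a) q i - s * \sum_(b | ~~ [disjoint S a & S b]%B)
      w b * \prod_(i in (S a :|: S b)%SET) q i) *
    bern_mean q (fun g => expR (- s * weighted_count g)) <=
  bern_mean q (fun g => all_on (S a) g * expR (- s * weighted_count g)).
Proof.
move=> s0.
pose Y g : R := \sum_(b | ~~ [disjoint S a & S b]%B) w b * all_on (S b) g.
pose Z g : R := \sum_(b | [disjoint S a & S b]%B) w b * all_on (S b) g.
have XYZ g : weighted_count g = Y g + Z g.
  by rewrite /weighted_count (bigID (fun b => [disjoint S a & S b]%B))/= addrC.
have f01 i : 0 <= force (S a) q i <= 1.
  by rewrite /force; case: ifP => // _; rewrite ler01 lexx.
have p0 : 0 <= \prod_(i in S a) q i.
  by apply: prodr_ge0 => i _; case/andP: (q01 i).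
have Y0 g : 0 <= Y g by apply: sumr_ge0 => b _; rewrite mulr_ge0// all_on_ge0.
have E0 u : 0 <= bern_mean q (fun g => expR (u g)).
  by apply: sumr_ge0 => g _; rewrite mulr_ge0// ?bern_weight_ge0// expR_ge0.
have step1 : (\prod_(i in S a) q i) *
    (bern_mean (force (S a) q) (fun g => expR (- s * Y g)) *
     bern_mean (force (S a) q) (fun g => expR (- s * Z g))) <=
    bern_mean q (fun g => all_on (S a) g * expR (- s * weighted_count g)).
  rewrite bern_mean_all_on ler_wpM2l//.
  apply: le_trans (harris f01 (decreasing_expR _ s0) (decreasing_expR _ s0)) _.
  rewrite le_eqVlt; apply/orP; left; apply/eqP; apply: eq_bern_mean => g.
  by rewrite XYZ mulrDr expRD.
apply: le_trans step1.
have -> : bern_mean (force (S a) q) (fun g => expR (- s * Z g)) =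
    bern_mean q (fun g => expR (- s * Z g)).
  apply: (@bern_mean_outside _ _ _ _ (S a)) => [g g' gg'|i /negPf iS].
    congr (expR (_ * _)); apply: eq_bigr => b ab; congr (_ * _).
    exact: all_on_outside ab _ _ gg'.
  by rewrite /force iS.
have ZX : bern_mean q (fun g => expR (- s * weighted_count g)) <=
    bern_mean q (fun g => expR (- s * Z g)).
  apply: bern_mean_le => // g; rewrite ler_expR !mulNr lerN2 ler_wpM2l//.
  by rewrite XYZ lerDr.
rewrite mulrA; apply: (@le_trans _ _
  ((\prod_(i in S a) q i) * bern_mean (force (S a) q) (fun g => expR (- s * Y g)) *
    bern_mean q (fun g => expR (- s * weighted_count g)))); last first.
  rewrite ler_wpM2l// mulr_ge0//; apply: sumr_ge0 => g _.
  by rewrite mulr_ge0// ?bern_weight_ge0// expR_ge0.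
rewrite ler_wpM2r// -bern_mean_all_on.
(* The bound [expR (- s * Y g) >= 1 - s * Y g] is used for the overlapping copies only; its linear
   term produces the sum over [b]. *)
apply: (@le_trans _ _ (bern_mean q (fun g => all_on (S a) g + (- s) *
    \sum_(b | ~~ [disjoint S a & S b]%B) w b * (all_on (S a) g * all_on (S b) g)))).
  rewrite bern_meanD bern_mean_all_on1 bern_meanZ bern_mean_sum mulNr.
  rewrite lerD2l lerN2 ler_wpM2l//; apply: ler_sum => b _.
  rewrite bern_meanZ ler_wpM2l// -bern_mean_all_on1.
  by apply: bern_mean_le => // g; rewrite all_onU.
apply: bern_mean_le => // g.
rewrite (_ : _ + _ = all_on (S a) g * (1 + - s * Y g)); last first.
  rewrite mulrDr mulr1; congr (_ + _); rewrite mulrCA; congr (_ * _).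
  by rewrite mulr_sumr; apply: eq_bigr => b _; rewrite mulrCA.
by rewrite ler_wpM2l ?all_on_ge0// expR_ge1Dx.
Qed.

(** The right-hand side is minus the derivative in [s] of the Laplace transform of the count, so
    this is the differential inequality behind [janson]. It is [harris_on] summed over [a] with
    weights [w a]. *)
Lemma janson_derivative (s : R) : 0 <= s ->
  (count_mean - s * overlap_mean) *
    bern_mean q (fun g => expR (- s * weighted_count g)) <=
  bern_mean q (fun g => weighted_count g * expR (- s * weighted_count g)).
Proof.
move=> s0.
apply: (@le_trans _ _ (\sum_a w a * bern_mean q
    (fun g => all_on (S a) g * expR (- s * weighted_count g)))); last first.
  under eq_bigr do rewrite -bern_meanZ.
  rewrite -bern_mean_sum; apply: bern_mean_le => // g.
  rewrite [leRHS]mulr_suml le_eqVlt; apply/orP; left; apply/eqP.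
  by apply: eq_bigr => a _; rewrite mulrA.
rewrite /count_mean /overlap_mean [s * _]mulr_sumr -sumrB [leLHS]mulr_suml.
apply: ler_sum => a _; rewrite -subr_ge0.
have := harris_on a s0; rewrite -subr_ge0 => /(mulr_ge0 (w0 a)).
congr (_ <= _); rewrite mulrBr; congr (_ - _); rewrite mulrA; congr (_ * _).
rewrite mulrBr; congr (_ - _); rewrite mulrCA; congr (_ * _).
by rewrite mulr_sumr; apply: eq_bigr => b _; rewrite mulrA.
Qed.

(** The quotient [F] of the two sides equals 1 at 0, and [janson_derivative] says exactly that its
    derivative is nonpositive on the positive half-line. *)
Lemma janson (s : R) : 0 <= s ->
  bern_mean q (fun g => expR (- s * weighted_count g)) <=
  expR (- s * count_mean + s ^+ 2 * overlap_mean / 2).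
Proof.
move=> s0.
pose e x g : R := x * count_mean - x ^+ 2 * overlap_mean / 2 - x * weighted_count g.
pose F x : R := bern_mean q (fun g => expR (e x g)).
have dF (x : R) : is_derive x 1 F (bern_mean q (fun g =>
    (count_mean - x * overlap_mean - weighted_count g) * expR (e x g))).
  apply: is_derive_bigsum => g.
  rewrite (_ : (fun _ => _) = (bern_weight q g) \*: (expR \o (e ^~ g))); last first.
    exact/funext.
  apply: is_deriveZ.
  have de : is_derive x 1 (e ^~ g)
      (count_mean - x * overlap_mean - weighted_count g).
    rewrite /e.
    apply: is_derive_eq.
    by rewrite !scaler0 /GRing.scale/= !mulr1; field.
  by apply: is_derive_eq; rewrite /GRing.scale/= mulrC.
have Fle : F s <= F 0.
  apply: (@ler0_derive1_nincry _ F 0) => //.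
  - move=> x; rewrite in_itv/= andbT => x0.
    rewrite derive1E (@derive_val _ _ _ _ _ _ _ (dF x)).
    have := janson_derivative (ltW x0); rewrite -subr_ge0.
    have c0 := expR_ge0 (x * count_mean - x ^+ 2 * overlap_mean / 2).
    move=> /(mulr_ge0 c0); rewrite -oppr_le0; congr (_ <= _).
    rewrite -mulrN opprB mulrBr !mulrA -!bern_meanZ -mulN1r -bern_meanZ -bern_meanD.
    apply: eq_bern_mean => g.
    have -> : expR (e x g) = expR (x * count_mean - x ^+ 2 * overlap_mean / 2) *
        expR (- x * weighted_count g) by rewrite -expRD mulNr.
    by ring.
  - apply/continuous_subspaceT => x; apply: differentiable_continuous.
    by apply/derivable1_diffP; have [] := dF x.
have F0 : F 0 = 1.
  rewrite /F -(bern_mean1 q); apply: eq_bern_mean => g.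
  by rewrite /e !mul0r expr0n/= !mul0r !subr0 expR0.
have FE : F s = expR (s * count_mean - s ^+ 2 * overlap_mean / 2) *
    bern_mean q (fun g => expR (- s * weighted_count g)).
  by rewrite -bern_meanZ; apply: eq_bern_mean => g; rewrite /e -expRD mulNr.
move: Fle; rewrite F0 FE -ler_pdivlMl ?expR_gt0// mulr1 -expRN.
by congr (_ <= expR _); ring.
Qed.

Lemma janson_lower_tail (t D : R) : 0 <= t -> 0 < D -> overlap_mean <= D ->
  bern_mean q (fun g => (weighted_count g <= count_mean - t)%R%:R) <=
  expR (- (t ^+ 2 / (2 * D))).
Proof.
(* This [s] minimises the exponent [- s * t + s ^+ 2 * D / 2] left by Markov's inequality. *)
move=> t0 D0 oD; pose s := t / D.
have s0 : 0 <= s by rewrite divr_ge0// ltW.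
apply: (@le_trans _ _ (bern_mean q (fun g =>
    expR (s * (count_mean - t)) * expR (- s * weighted_count g)))).
  apply: bern_mean_le => // g; rewrite -expRD.
  case: (boolP (weighted_count g <= count_mean - t)) => [Xt|_]; last exact: expR_ge0.
  have -> : (true%:R : R) = expR 0 by rewrite expR0.
  by rewrite ler_expR; have := ler_wpM2l s0 Xt; lra.
rewrite bern_meanZ; apply: (@le_trans _ _ (expR (s * (count_mean - t)) *
    expR (- s * count_mean + s ^+ 2 * overlap_mean / 2))).
  by rewrite ler_wpM2l ?expR_ge0// janson.
rewrite -expRD ler_expR.
apply: (@le_trans _ _ (- s * t + s ^+ 2 * D / 2)).
  have : s ^+ 2 * overlap_mean <= s ^+ 2 * D by rewrite ler_wpM2l// sqr_ge0.
  by lra.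
by rewrite /s le_eqVlt; apply/orP; left; apply/eqP; field; rewrite gt_eqF.
Qed.

(** Chebyshev: the covariance of two copies vanishes when they share no bit, and is otherwise at
    most the mean of their product. *)
Lemma count_upper_tail (t : R) : 0 < t ->
  bern_mean q (fun g => (count_mean + t <= weighted_count g)%R%:R) <=
  overlap_mean / t ^+ 2.
Proof.
move=> t0; have t20 : 0 < t ^+ 2 by rewrite exprn_gt0.
pose p a := \prod_(i in S a) q i.
have p0 a : 0 <= p a by apply: prodr_ge0 => i _; case/andP: (q01 i).
apply: (@le_trans _ _ (bern_mean q (fun g =>
    (t ^+ 2)^-1 * (weighted_count g - count_mean) ^+ 2))).
  apply: bern_mean_le => // g.
  case: (boolP (count_mean + t <= weighted_count g)) => [Xt|_].
    by rewrite ler_pdivlMl// mulr1 ler_pXn2r// ?nnegrE ?(ltW t0)//; lra.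
  by rewrite mulr_ge0// ?sqr_ge0// invr_ge0 ltW.
rewrite bern_meanZ mulrC ler_pM2r ?invr_gt0//.
rewrite (@eq_bern_mean _ _ _ _ (fun g => \sum_a \sum_b w a * w b *
    (all_on (S a :|: S b)%SET g + (- p b) * all_on (S a) g +
     (- p a) * all_on (S b) g + p a * p b * 1))); last first.
  move=> g; rewrite /weighted_count /count_mean -sumrB expr2 mulr_suml.
  apply: eq_bigr => a _; rewrite mulr_sumr; apply: eq_bigr => b _.
  by rewrite -all_onU /p; ring.
rewrite bern_mean_sum; apply: ler_sum => a _; rewrite bern_mean_sum.
rewrite (bigID (fun b => [disjoint S a & S b]%B))/= big1 ?add0r => [|b ab].
  apply: ler_sum => b ab; rewrite bern_meanZ ler_wpM2l ?mulr_ge0//.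
  rewrite !bern_meanD !bern_meanZ !bern_mean_all_on1 bern_mean1 -!/(p _).
  by have := mulr_ge0 (p0 a) (p0 b); lra.
rewrite bern_meanZ !bern_meanD !bern_meanZ !bern_mean_all_on1 bern_mean1 -!/(p _).
rewrite [\prod_(i in _) _](_ : _ = p a * p b); first by ring.
by rewrite /p -bigU//=; apply: eq_bigl => i; rewrite inE.
Qed.

End janson.

(** * Overlapping copies of a graph *)

Lemma sum_tuple_prod (R : comNzSemiRingType) (T : finType) (k : nat)
    (F : 'I_k -> T -> R) :
  \sum_(t : k.-tuple T) \prod_(a < k) F a (tnth t a) = \prod_(a < k) \sum_x F a x.
Proof.
rewrite bigA_distr_bigA/=.
rewrite (reindex (fun f : {ffun 'I_k -> T} => [tuple f a | a < k]))/=.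
  by apply: eq_bigr => f _; apply: eq_bigr => a _; rewrite tnth_mktuple.
exists (fun t : k.-tuple T => [ffun a => tnth t a]) => [f _|t _].
  by apply/ffunP => a; rewrite ffunE tnth_mktuple.
by apply: eq_from_tnth => a; rewrite tnth_mktuple ffunE.
Qed.

Section copies.
Context {R : realType} {v : nat}.
Variables (H : rel 'I_v) (n : nat).

Definition pair_key (x y : 'I_n) : 'I_n * 'I_n := if (x < y)%N then (x, y) else (y, x).

Definition copy_edges (i : v.-tuple 'I_n) : {set 'I_n * 'I_n} :=
  [set pair_key (tnth i ab.1) (tnth i ab.2) | ab in edges H]%SET.

Definition edges_in (F : {set 'I_v}) : {set 'I_v * 'I_v} :=
  [set ab in edges H | (ab.1 \in F) && (ab.2 \in F)]%SET.

Lemma pair_key_cases x y z t : pair_key x y = pair_key z t ->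
  (x = z /\ y = t) \/ (x = t /\ y = z).
Proof. by rewrite /pair_key; do 2!case: ifP => _; case=> -> ->; auto. Qed.

Lemma copy_edges_inj (i : v.-tuple 'I_n) : uniq i ->
  {in edges H &, injective (fun ab => pair_key (tnth i ab.1) (tnth i ab.2))}.
Proof.
move=> /tuple_uniqP ui [a b] [a' b']; rewrite !inE/= => /andP[ab _] /andP[ab' _].
move=> /pair_key_cases[[/ui -> /ui ->]//|[/ui aE /ui bE]].
by move: ab ab'; rewrite aE bE; lia.
Qed.

Lemma card_copy_edges (i : v.-tuple 'I_n) : uniq i -> #|copy_edges i| = #|edges H|.
Proof. by move=> ui; rewrite card_in_imset//; exact: copy_edges_inj. Qed.

Lemma pair_key_lt x y : x != y -> ((pair_key x y).1 < (pair_key x y).2)%N.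
Proof. by rewrite /pair_key -val_eqE/= neq_ltn; case: ltnP. Qed.

Lemma copy_edges_lt (i : v.-tuple 'I_n) xy : uniq i -> xy \in copy_edges i ->
  (xy.1 < xy.2)%N.
Proof.
move=> /tuple_uniqP ui /imsetP[[a b]]; rewrite inE/= => /andP[ab _] ->.
apply: pair_key_lt; apply: contraTneq ab => /ui ->; by rewrite ltnn.
Qed.

Variable p : R.
Hypothesis p01 : 0 <= p <= 1.

(* Bits are indexed by all ordered pairs; only those with xy.1 < xy.2 are read,
   the other ones are false almost surely. *)
Definition pair_prob (xy : 'I_n * 'I_n) : R := if (xy.1 < xy.2)%N then p else 0.

Lemma pair_prob01 xy : 0 <= pair_prob xy <= 1.
Proof. by rewrite /pair_prob; case: ifP => // _; rewrite lexx ler01. Qed.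

Lemma copy_prob (i : v.-tuple 'I_n) : uniq i ->
  \prod_(xy in copy_edges i) pair_prob xy = p ^+ #|edges H|.
Proof.
move=> ui; rewrite -(card_copy_edges ui) -prodr_const; apply: eq_bigr => xy.
by move=> /(copy_edges_lt ui) h; rewrite /pair_prob h.
Qed.

Definition overlap (i j : v.-tuple 'I_n) : {set 'I_v} :=
  [set k | tnth i k \in (j : seq _)]%SET.

(** Both ends of a shared edge are shared vertices, so the edge comes, through [i], from an edge of
    [H] inside the overlap. The overlap is a set of positions in [H], which makes its edge count a
    quantity of [H] alone. *)
Lemma copy_edges_capI (i j : v.-tuple 'I_n) :
  (copy_edges i :&: copy_edges j \subset
   [set pair_key (tnth i ab.1) (tnth i ab.2) | ab in edges_in (overlap i j)])%SET.
Proof.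
apply/fintype.subsetP => xy /finset.setIP[/imsetP[ab abE ->] /imsetP[ab' _ e]].
apply/imsetP; exists ab => //; rewrite inE abE/= !inE.
by case: (pair_key_cases e) => -[-> ->]; rewrite !mem_tnth.
Qed.

Lemma overlap_prob (i j : v.-tuple 'I_n) : uniq i -> uniq j ->
  \prod_(xy in (copy_edges i :|: copy_edges j)%SET) pair_prob xy <=
  p ^+ (2 * #|edges H| - #|edges_in (overlap i j)|).
Proof.
move=> ui uj.
rewrite (eq_bigr (fun=> p)); last first.
  by move=> xy /finset.setUP[/(copy_edges_lt ui)|/(copy_edges_lt uj)] h;
    rewrite /pair_prob h.
rewrite prodr_const; apply: ler_wiXn2l => //.
- by case/andP: p01.
- by case/andP: p01.
rewrite cardsU !card_copy_edges// mul2n addnn leq_sub2l//.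
by apply: leq_trans (subset_leq_card (copy_edges_capI i j)) (leq_imset_card _ _).
Qed.

Lemma card_overlap (i j : v.-tuple 'I_n) :
  ~~ [disjoint copy_edges i & copy_edges j]%B -> (2 <= #|overlap i j|)%N.
Proof.
rewrite -setI_eq0 => /set0Pn[xy xyij].
have /imsetP[[a b]] := fintype.subsetP (copy_edges_capI i j) _ xyij.
rewrite !inE/= => /andP[/andP[ab _] /andP[aj bj]] _.
have <- : #|[set a; b]%SET| = 2%N by rewrite cards2 -val_eqE/= neq_ltn ab.
by apply/subset_leq_card/fintype.subsetP => k /set2P[] ->; rewrite inE.
Qed.

(** With [j] fixed, a position in [F] has at most [v] possible values, the entries of [j], and any
    other position at most [n]. *)
Lemma sum_overlap (F : {set 'I_v}) (j : v.-tuple 'I_n) :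
  \sum_(i : v.-tuple 'I_n | F == overlap i j) (1 : R) <=
  v%:R ^+ #|F| * n%:R ^+ (v - #|F|).
Proof.
apply: (@le_trans _ _ (\sum_(i : v.-tuple 'I_n)
    \prod_(k < v) ((k \in F) ==> (tnth i k \in (j : seq _)))%:R)).
  rewrite [leLHS]big_mkcond; apply: ler_sum => i _; case: eqP => [->|_].
    rewrite big1// => k _; rewrite inE; by case: (_ \in _).
  exact: prodr_ge0.
rewrite (sum_tuple_prod (fun k x => ((k \in F) ==> (x \in (j : seq _)))%:R)).
have -> : v%:R ^+ #|F| * n%:R ^+ (v - #|F|) =
    \prod_(k < v) (if k \in F then v%:R else n%:R) :> R.
  rewrite (bigID (mem F))/= (eq_bigr (fun=> v%:R)); last by move=> k ->.
  rewrite [X in _ = _ * X](eq_bigr (fun=> n%:R)); last by move=> k /negPf ->.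
  rewrite !prodr_const; congr (_ * _ ^+ _).
  have := cardC (mem F); rewrite card_ord => {1}<-.
  by rewrite addKn; apply: eq_card => k; rewrite !inE.
apply: ler_prod => k _; rewrite sumr_ge0//=; case: ifP => kF /=.
  rewrite -natr_sum ler_nat.
  rewrite (_ : (\sum_x _)%N = #|(j : seq 'I_n)|); last first.
    by rewrite -sum1_card [RHS]big_mkcond; apply: eq_bigr => x _; case: (x \in _).
  by rewrite (leq_trans (card_size j))// size_tuple.
by rewrite sumr_const card_ord.
Qed.

(** Pairs are sorted by their overlap [F]. By [sum_overlap] and [overlap_prob], those with overlap
    [F] contribute, up to [B ^+ 2 * v%:R ^+ v], at most (n^v p^e(H))^2 / (n^|F| p^e(F)), and [L]
    bounds the last denominator below. The factor [2 ^+ v] counts the sets [F]; sharing an edge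
    forces |F| >= 2. *)
Lemma overlap_mean_le (w : v.-tuple 'I_n -> R) (B L : R) : 0 < p -> (0 < n)%N ->
  (forall i, 0 <= w i <= B) -> (forall i : v.-tuple 'I_n, ~~ uniq i -> w i = 0) -> 0 < L ->
  (forall F : {set 'I_v}, (2 <= #|F|)%N -> L <= n%:R ^+ #|F| * p ^+ #|edges_in F|) ->
  overlap_mean pair_prob copy_edges w <=
  B ^+ 2 * (v%:R ^+ v * 2 ^+ v) * (n%:R ^+ v * p ^+ #|edges H|) ^+ 2 / L.
Proof.
move=> p0 n0 wB wu L0 FL.
have nR0 : 0 < (n%:R : R) by rewrite ltr0n.
have w0 i : 0 <= w i by case/andP: (wB i).
have wC i j : w i * w j <= B ^+ 2.
  by rewrite expr2 ler_pM//; [case/andP: (wB i)|case/andP: (wB j)].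
move: (B ^+ 2) (sqr_ge0 B) wC => C C0 wC.
have p_ge0 : 0 <= p by exact: ltW.
pose q (F : {set 'I_v}) : R := p ^+ (2 * #|edges H| - #|edges_in F|).
have q0 F : 0 <= q F by rewrite exprn_ge0.
apply: (@le_trans _ _ (\sum_(j : v.-tuple 'I_n)
   \sum_(F : {set 'I_v} | (2 <= #|F|)%N)
   \sum_(i : v.-tuple 'I_n | F == overlap i j) C * q F)).
  rewrite /overlap_mean (exchange_big_dep xpredT)//=; apply: ler_sum => j _.
  rewrite [leRHS](exchange_big_dep xpredT)//= [leLHS]big_mkcond/=.
  apply: ler_sum => i _.
  have s0 : 0 <= \sum_(F : {set 'I_v} | (2 <= #|F|)%N && (F == overlap i j))
      C * q F by apply: sumr_ge0 => F _; rewrite mulr_ge0//.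
  case: ifPn => // ij.
  have [ui|/wu ->] := boolP (uniq i); last by rewrite !mul0r.
  have [uj|/wu ->] := boolP (uniq j); last by rewrite mulr0 mul0r.
  rewrite (bigD1 (overlap i j))/= ?eqxx ?andbT ?card_overlap//.
  rewrite [X in _ + X]big_pred0 ?addr0; last by move=> F; case: eqP; rewrite ?andbF.
  rewrite ler_pM ?mulr_ge0// ?overlap_prob//.
  by apply: prodr_ge0 => xy _; case/andP: (pair_prob01 xy).
apply: (@le_trans _ _ (\sum_(j : v.-tuple 'I_n)
   \sum_(F : {set 'I_v} | (2 <= #|F|)%N)
   C * v%:R ^+ v * (n%:R ^+ v * p ^+ (2 * #|edges H|) / L))).
  apply: ler_sum => j _; apply: ler_sum => F F2.
  rewrite (eq_bigr (fun=> C * q F * 1)); last by move=> *; rewrite mulr1.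
  rewrite -mulr_sumr -!mulrA ler_wpM2l //.
  have Fv : (#|F| <= v)%N by rewrite -[X in (_ <= X)%N]card_ord max_card.
  have eF : (#|edges_in F| <= 2 * #|edges H|)%N.
    rewrite (leq_trans (subset_leq_card _) (leq_pmull _ _))//.
    by apply/fintype.subsetP => ab; rewrite inE => /andP[].
  apply: (@le_trans _ _ (q F * (v%:R ^+ #|F| * n%:R ^+ (v - #|F|)))).
    by rewrite ler_wpM2l// sum_overlap.
  rewrite mulrCA; apply: ler_pM; rewrite ?mulr_ge0 ?exprn_ge0//.
    apply: ler_weXn2l => //; rewrite ler1n; lia.
  rewrite mulrA ler_pdivlMr// /q.
  apply: (@le_trans _ _ (p ^+ (2 * #|edges H| - #|edges_in F|) *
      n%:R ^+ (v - #|F|) * (n%:R ^+ #|F| * p ^+ #|edges_in F|))).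
    by rewrite ler_wpM2l ?FL// mulr_ge0 ?exprn_ge0.
  have -> : n%:R ^+ v = n%:R ^+ (v - #|F|) * n%:R ^+ #|F| :> R by rewrite -exprD subnK.
  rewrite -[X in _ <= _ * p ^+ X](subnK eF) exprD le_eqVlt.
  by apply/orP; left; apply/eqP; ring.
apply: (@le_trans _ _ (\sum_(j : v.-tuple 'I_n) \sum_(F : {set 'I_v})
   C * v%:R ^+ v * (n%:R ^+ v * p ^+ (2 * #|edges H|) / L))).
  apply: ler_sum => j _; rewrite [leRHS](bigID (fun F : {set 'I_v} => (2 <= #|F|)%N))/=.
  rewrite lerDl sumr_ge0// => F _.
  by rewrite mulr_ge0 ?divr_ge0 ?mulr_ge0 ?exprn_ge0// ltW.
rewrite !sumr_const card_tuple card_ord.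
rewrite (_ : #|{set 'I_v}| = (2 ^ v)%N); last first.
  by rewrite -cardsT -powersetT card_powerset cardsT card_ord.
rewrite -[leLHS]mulr_natr -[X in X * _ <= _]mulr_natr !natrX le_eqVlt.
apply/orP; left; apply/eqP.
by rewrite mulnC exprM; field; rewrite gt_eqF.
Qed.

End copies.

(** * Density of the subgraphs *)

Section edge_counting.
Context {v : nat}.
Variables (H : rel 'I_v).
Hypothesis H_simple : simple_graph H.

Lemma degreeE (F : rel 'I_v) x : degree F x = #|[set y | F x y]%SET|.
Proof. by apply: eq_card => y; apply/idP/idP; rewrite !inE. Qed.

Lemma handshake_le (F : {set 'I_v}) :
  (2 * #|edges_in H F| <= \sum_(x in F) degree (Defs.induced H F) x)%N.
Proof.
have [symH _] := H_simple.
pose sw (xy : 'I_v * 'I_v) := (xy.2, xy.1).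
have swK : involutive sw by case.
rewrite (_ : (\sum_(x in F) _)%N = #|[set xy | Defs.induced H F xy.1 xy.2]%SET|); last first.
  rewrite -sum1dep_card (eq_bigr (fun x => \sum_(y | Defs.induced H F x y) 1)%N); last first.
    by move=> x _; rewrite degreeE -sum1dep_card.
  rewrite (pair_big_dep _ (fun x y => Defs.induced H F x y))/=; apply: eq_bigl => -[x y]/=.
  by rewrite /Defs.induced; case: (x \in F).
rewrite mul2n -addnn -{2}(card_imset (edges_in H F) (inv_inj swK)).
have dis : [disjoint edges_in H F & sw @: edges_in H F]%B.
  apply/pred0P => -[x y]/=; apply/negbTE/negP => /andP[].
  rewrite !inE/= => /andP[/andP[xy _] _] /imsetP[[a b]].
  by rewrite !inE/= => /andP[/andP[ab _] _] [xE yE]; move: xy ab; rewrite xE yE; lia.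
have [_] := leq_card_setU (edges_in H F) [set sw x | x in edges_in H F]%SET.
rewrite dis => /eqP <-.
apply/subset_leq_card/fintype.subsetP => xy /finset.setUP[|/imsetP[{}xy + ->]];
  rewrite !inE /Defs.induced => /andP[/andP[_ xyH] /andP[xF yF]].
  by rewrite xF yF xyH.
by rewrite /= xF yF symH.
Qed.

Lemma card_edges_in_remove (F : {set 'I_v}) (x : 'I_v) : x \in F ->
  (#|edges_in H F| <= #|edges_in H (F :\ x)%SET| + degree (Defs.induced H F) x)%N.
Proof.
move=> xF; have [symH _] := H_simple.
pose k (y : 'I_v) := if (x < y)%N then (x, y) else (y, x).
apply: (@leq_trans #|(edges_in H (F :\ x) :|:
    [set k y | y in [set y | Defs.induced H F x y]])%SET|).
  apply/subset_leq_card/fintype.subsetP => -[a b]; rewrite !inE/=.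
  move=> /andP[/andP[ab Hab] /andP[aF bF]]; rewrite ab Hab aF bF/= !andbT.
  have [ax|ax] := eqVneq a x.
    rewrite /=; apply/imsetP; exists b; first by rewrite inE /Defs.induced -ax aF bF.
    by rewrite /k -ax ab.
  have [bx|//] := eqVneq b x.
  rewrite /=; apply/imsetP; exists a; first by rewrite inE /Defs.induced -bx aF bF symH.
  by rewrite /k -bx ltnNge ltnW.
rewrite (leq_trans (leq_card_setU _ _))// leq_add2l.
by rewrite degreeE; exact: leq_imset_card.
Qed.

Lemma two_core_max_degree_cases :
  two_core_max_degree H = 0%N \/ (2 <= two_core_max_degree H)%N.
Proof.
have [/eqP|/set0Pn[x xH]] := boolP (two_core_vert H == finset.set0).
  by rewrite /two_core_max_degree => ->; left; rewrite big_pred0// => i; rewrite inE.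
right; apply: leq_trans (two_core_min_degree2 xH) _.
exact: (@leq_bigmax_cond _ (mem (two_core_vert H))).
Qed.

(* Induction on F: removing a vertex of degree at most 1 divides
   n^|F| p^e(F) by at least n p >= 1. *)
Lemma copies_density (R : realFieldType) (N p z : R) (F : {set 'I_v}) :
  (2 <= two_core_max_degree H)%N -> 0 < p <= 1 -> 1 <= z <= N ->
  z <= N ^+ 2 * p ^+ two_core_max_degree H -> (2 <= #|F|)%N ->
  z ^+ 3 <= (N ^+ #|F| * p ^+ #|edges_in H F|) ^+ 2.
Proof.
have : forall x, x \in two_core_vert H ->
    (degree (two_core_adj H) x <= two_core_max_degree H)%N.
  move=> x; exact: (@leq_bigmax_cond _ (mem (two_core_vert H))).
move: (two_core_max_degree H) => D core_deg D2 /andP[p0 p1] /andP[z1 zN] zD.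
have z0 : 0 <= z := le_trans ler01 z1.
have N0 : 0 <= N := le_trans z0 zN.
(* Since [2 <= D], this gives [1 <= N * p] in squared form: the price of deleting a vertex of degree
   at most 1. *)
have zN2 : z <= N ^+ 2 * p ^+ 2.
  apply: le_trans zD _; rewrite ler_wpM2l ?sqr_ge0//.
  by apply: ler_wiXn2l => //; exact: ltW.
move: {2}#|F| (erefl #|F|) => k; elim: k F => [F ->//|k IH F Fk F2].
have [F2'|[x xF dx]] : (forall x, x \in F -> (2 <= degree (Defs.induced H F) x)%N) \/
    exists2 x, x \in F & (degree (Defs.induced H F) x <= 1)%N.
  have [h|h] := pselect (exists2 x, x \in F & (degree (Defs.induced H F) x <= 1)%N).
    by right.
  left=> x xF; rewrite ltnNge; apply/negP => dx; by apply: h; exists x.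
  have Fcore : F \subset two_core_vert H.
    by apply: (@finset.bigcup_sup _ _ F) => //; apply/forall_inP.
  (* A vertex has two neighbours in [F], both different from it. This is the origin of the exponent
     3. *)
  have F3 : (3 <= #|F|)%N.
    have /card_gt0P[x xF] : (0 < #|F|)%N by lia.
    rewrite (cardsD1 x F) xF add1n ltnS; apply: leq_trans (F2' x xF) _.
    rewrite degreeE.
    apply/subset_leq_card/fintype.subsetP => y; rewrite !inE => /and3P[_ yF xy].
    rewrite yF andbT; apply: contraTneq xy => ->; by case: H_simple => _ ->.
  have eD : (2 * #|edges_in H F| <= D * #|F|)%N.
    apply: leq_trans (handshake_le F) _.
    rewrite mulnC -sum_nat_const; apply: leq_sum => x xF.
    apply: (@leq_trans (degree (two_core_adj H) x)).
      apply: degree_sub => y /and3P[_ yF xy]; rewrite /two_core_adj /Defs.induced xy.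
      by rewrite !(fintype.subsetP Fcore).
    exact/core_deg/(fintype.subsetP Fcore).
  apply: (@le_trans _ _ (z ^+ #|F|)); first by apply: ler_weXn2l.
  rewrite exprMn -!exprM.
  apply: (@le_trans _ _ ((N ^+ 2 * p ^+ D) ^+ #|F|)).
    by apply: lerXn2r => //; rewrite nnegrE// (le_trans z0).
  rewrite exprMn -!exprM [(#|F| * 2)%N]mulnC ler_wpM2l ?exprn_ge0//.
  by apply: ler_wiXn2l; rewrite ?(ltW p0)//; lia.
have FxS : #|F| = #|(F :\ x)%SET|.+1 by rewrite (cardsD1 x) xF.
have e1 : (#|edges_in H F| <= #|edges_in H (F :\ x)%SET|.+1)%N.
  by rewrite (leq_trans (card_edges_in_remove xF))// -addn1 leq_add2l.
(* Two vertices span at most one edge, and (N^2 p)^2 = N^2 (N^2 p^2) >= z^2 z. *)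
have [F2e|Fx2] : #|F| = 2%N \/ (2 <= #|(F :\ x)%SET|)%N by lia.
  have e0 : (#|edges_in H F| <= 1)%N.
    have /cards1P[y yE] : #|(F :\ x)%SET| == 1%N by lia.
    apply: leq_trans e1 _; rewrite ltnS leqn0 cards_eq0 yE.
    apply/eqP/setP => -[a b]; rewrite !inE/=.
    apply/negP => /andP[/andP[ab _] /andP[/eqP ay /eqP by_]].
    by move: ab; rewrite ay by_ ltnn.
  rewrite F2e exprMn.
  apply: (@le_trans _ _ (N ^+ 2 * (N ^+ 2 * p ^+ 2))); last first.
    rewrite mulrA -expr2 ler_wpM2l ?sqr_ge0// -exprM.
    by apply: ler_wiXn2l; rewrite ?(ltW p0)//; lia.
  rewrite exprSr ler_pM ?exprn_ge0//.
  by apply: lerXn2r; rewrite ?nnegrE.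
have Fxk : #|(F :\ x)%SET| = k by move: FxS; rewrite Fk => -[].
apply: le_trans (IH _ Fxk Fx2) _; rewrite Fxk Fk.
apply: (@le_trans _ _ ((N ^+ 2 * p ^+ 2) * (N ^+ k * p ^+ #|edges_in H (F :\ x)%SET|) ^+ 2)).
  by rewrite ler_peMl ?sqr_ge0// (le_trans z1).
rewrite -!exprMn; apply: lerXn2r; rewrite ?nnegrE ?mulr_ge0 ?exprn_ge0 ?(ltW p0)//.
rewrite mulrACA -!exprS ler_wpM2l ?mulr_ge0 ?exprn_ge0//.
by apply: ler_wiXn2l; rewrite ?(ltW p0).
Qed.

End edge_counting.

(** * Asymptotics of the subgraph densities *)

Lemma cubic_log_le (R : realType) (K : R) :
  \forall n \near \oo, [/\ 1 <= ln (n%:R : R), ln (n%:R : R) <= n%:R &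
    K ^+ 2 * n%:R ^+ 2 <= (n%:R / ln n%:R) ^+ 3].
Proof.
near=> n.
have n0 : 0 < (n%:R : R) by rewrite ltr0n; near: n; exact: nbhs_infty_gt.
(* With n = y^6 one has ln n = 6 ln y < 6 y, so (n / ln n)^3 >= y^15 / 216 while the left-hand side
   is K^2 y^12. Any y with 216 K^2 <= y^3 suffices; the constant is 6^3. *)
pose y : R := n%:R `^ (6^-1).
have y0 : 0 < y by exact: powR_gt0.
have y6 : y ^+ 6 = n%:R.
  rewrite -powR_mulrn ?(ltW y0)// -powRrM mulVf// powRr1// ltW.
have lny : ln y < y by exact: ln_sublinear.
have lnn : ln (n%:R : R) = 6 * ln y by rewrite -y6 lnXn// mulr_natl.
have ln1 : 1 <= ln (n%:R : R).
  rewrite -[leLHS]expRK ler_ln ?posrE ?expR_gt0//.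
  by near: n; exact: nbhs_infty_ger.
pose M : R := 216 * K ^+ 2 + 1.
have M1 : 1 <= M by rewrite lerDr mulr_ge0// sqr_ge0.
have yM : M <= y.
  have : M ^+ 6 <= y ^+ 6 by rewrite y6; near: n; exact: nbhs_infty_ger.
  by rewrite ler_pXn2r// nnegrE ?(ltW y0)//; lra.
split=> //; first exact/ltW/ln_sublinear.
apply: (@le_trans _ _ ((y ^+ 6 / (6 * y)) ^+ 3)).
  have -> : (y ^+ 6 / (6 * y)) ^+ 3 = y ^+ 12 * y ^+ 3 / 216.
    by field; rewrite gt_eqF.
  rewrite -y6 -exprM mulrC -mulrA ler_wpM2l ?exprn_ge0 ?(ltW y0)//.
  rewrite ler_pdivlMr//; apply: (@le_trans _ _ y); first by rewrite /M in yM; lra.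
  by rewrite -[leLHS]expr1; apply: ler_weXn2l; rewrite // (le_trans M1).
have l0 : 0 < ln (n%:R : R) by lra.
apply: lerXn2r; rewrite ?nnegrE ?divr_ge0 ?exprn_ge0 ?mulr_ge0 ?(ltW y0) ?(ltW l0)//.
rewrite y6 ler_wpM2l ?(ltW n0)// lef_pV2 ?posrE ?mulr_gt0//.
by rewrite lnn ler_wpM2l// ltW.
Unshelve. all: by end_near. Qed.

(** The lower bound on [p] gives n^2 p^Delta >= n / ln n, so [copies_density] applies with
    [z = n%:R / ln n%:R], and z^3 exceeds (K n)^2 by [cubic_log_le]. *)
Lemma eventually_dense (R : realType) (v : nat) (H : rel 'I_v) (p : nat -> R) (K : R) :
  simple_graph H -> (forall n, 0 <= p n <= 1) ->
  much_less (fun n => (n%:R * ln n%:R) `^ (- (two_core_max_degree H)%:R^-1)) p ->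
  \forall n \near \oo, 0 < p n /\
    forall F : {set 'I_v}, (2 <= #|F|)%N ->
      K * n%:R <= n%:R ^+ #|F| * p n ^+ #|edges_in H F|.
Proof.
move=> Hs p01 [p_neq0 plow]; set D := two_core_max_degree H in plow.
near=> n.
have p0 : 0 < p n.
  rewrite lt_neqAle; case/andP: (p01 n) => -> _; rewrite andbT eq_sym.
  by near: n.
have p1 : p n <= 1 by case/andP: (p01 n).
have fp : (n%:R * ln n%:R) `^ (- D%:R^-1) < p n.
  have : `|(n%:R * ln n%:R) `^ (- D%:R^-1) / p n| < 1.
    near: n; have /cvgrPdist_lt/(_ 1 ltr01) := plow.
    by apply: filterS => n; rewrite sub0r normrN.
  rewrite ger0_norm; last by rewrite divr_ge0// ?powR_ge0// ltW.
  by rewrite ltr_pdivrMr// mul1r.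
split=> // F F2.
have [D0|D2] := two_core_max_degree_cases H.
  (* With an empty core the inverse of 0 is 0 in the library, so the exponent vanishes and [fp]
     reads [1 < p n]. *)
  by move: fp; rewrite /D D0 invr0 oppr0 powRr0 ltNge p1.
have [ln1 lnn Kn] : [/\ 1 <= ln (n%:R : R), ln (n%:R : R) <= n%:R &
    K ^+ 2 * n%:R ^+ 2 <= (n%:R / ln n%:R) ^+ 3].
  by near: n; exact: cubic_log_le.
have ln0 : 0 < ln (n%:R : R) by lra.
have n0 : 0 < (n%:R : R) by lra.
have zN : n%:R / ln n%:R <= n%:R ^+ 2 * p n ^+ D.
  have : (n%:R * ln n%:R)^-1 <= p n ^+ D.
    have -> : (n%:R * ln n%:R)^-1 = ((n%:R * ln n%:R) `^ (- D%:R^-1)) ^+ D :> R.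
      rewrite -powR_mulrn ?powR_ge0// -powRrM mulNr mulVf ?pnatr_eq0; last by lia.
      by rewrite powR_inv1// mulr_ge0// ltW.
    by apply: lerXn2r; rewrite ?nnegrE ?powR_ge0 ?(ltW p0) ?(ltW fp).
  move=> /(ler_wpM2l (sqr_ge0 n%:R)); apply: le_trans.
  rewrite le_eqVlt; apply/orP; left; apply/eqP; field.
  by rewrite !gt_eqF.
have := @copies_density _ _ Hs R n%:R (p n) (n%:R / ln n%:R) F D2.
rewrite p0 p1 ler_pdivlMr// mul1r lnn ler_pdivrMr// ler_peMr ?(ltW n0)//.
move=> /(_ isT isT zN F2) /(le_trans Kn).
have b0 : 0 <= n%:R ^+ #|F| * p n ^+ #|edges_in H F| by rewrite mulr_ge0 ?exprn_ge0// ltW.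
rewrite -exprMn => h.
have [K0|/ltW K0] := leP 0 (K * n%:R); last exact: le_trans K0 b0.
by move: h; rewrite ler_pXn2r// nnegrE.
Unshelve. all: by end_near. Qed.

(** * Homogeneous sums over colourings *)

(** At most v^2 n^(v-1) of the n^v tuples repeat an entry; multiplying by n and avoiding subtraction
    keeps this in the natural numbers. *)
Lemma ffact_lower (n v : nat) : (n ^ v.+1 <= n * n ^_ v + v ^ 2 * n ^ v)%N.
Proof.
have ff u : (n ^_ u <= n ^ u)%N.
  by elim: u => // u IH; rewrite ffactnSr expnSr leq_mul// leq_subr.
elim: v => [|v IH]; first by rewrite ffactn0 muln1 expn1 leq_addr.
have h2 : (n * n ^ v.+1 <= n * (n * n ^_ v + v ^ 2 * n ^ v))%N by rewrite leq_mul2l IH orbT.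
have -> : (v.+1 ^ 2 = v ^ 2 + 2 * v + 1)%N by rewrite -addn1 sqrnD; lia.
move: h2 (ff v); rewrite ffactnSr !expnS.
move: (n ^_ v)%N (n ^ v)%N => f e h2 fe.
have h1 : (n * (f * n) <= n * (f * (n - v)) + v * (n * e))%N.
  have fe' : (n * v * f <= n * v * e)%N by rewrite leq_mul2l fe orbT.
  have : (n * (f * n) <= n * (f * (n - v)) + n * v * f)%N.
    rewrite -mulnA -mulnDr leq_mul2l [(v * f)%N]mulnC -mulnDr leq_mul2l.
    by apply/orP; right; apply/orP; right; lia.
  by lia.
by lia.
Qed.

Section tuple_composition.
Context {v : nat} {T : Type}.

Definition permute_tuple (s : 'S_v) (i : v.-tuple T) : v.-tuple T :=
  [tuple tnth i (s a) | a < v].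

Lemma permute_tupleK (s : 'S_v) : cancel (permute_tuple s) (permute_tuple (s^-1)%g).
Proof.
by move=> i; apply: eq_from_tnth => a; rewrite !tnth_mktuple permKV.
Qed.

End tuple_composition.

Section empirical.
Context {R : realType} {v c : nat}.
Implicit Types (phi : v.-tuple (color c) -> R) (nu : color c -> R).

(** On the simplex this is the mean of [phi] at [v] independent colours of law [nu], and also the
    value of [G] at the constant [nu]. At an empirical measure it is N(1, phi, x). *)
Definition mean_poly phi nu : R := \sum_r phi r * \prod_(a < v) nu (tnth r a).

Definition empirical n (x : n.-tuple (color c)) (r : color c) : R :=
  n%:R^-1 * \sum_(i < n) (tnth x i == r)%:R.

Definition colors n (x : n.-tuple (color c)) (i : v.-tuple 'I_n) : v.-tuple (color c) :=
  [tuple tnth x (tnth i a) | a < v].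

Lemma mean_poly_empirical phi n (x : n.-tuple (color c)) :
  mean_poly phi (empirical x) = (n%:R ^+ v)^-1 * \sum_i phi (colors x i).
Proof.
rewrite (eq_bigr (fun i => \sum_r phi r *
    \prod_(a < v) (tnth x (tnth i a) == tnth r a)%:R)); last first.
  move=> i _; rewrite (bigD1 (colors x i))//= big1 => [|a _].
    rewrite mulr1 big1 ?addr0// => r rx; apply/eqP; rewrite mulf_eq0 orbC.
    have [a xr] : exists a, tnth x (tnth i a) != tnth r a.
      apply/existsP; apply: contraR rx; rewrite negb_exists => /forallP xr.
      apply/eqP/eq_from_tnth => a; rewrite tnth_mktuple.
      by apply/eqP; rewrite eq_sym -[_ == _]negbK.
    by rewrite (bigD1 a)//= (negPf xr) mul0r eqxx.
  by rewrite tnth_mktuple eqxx.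
rewrite exchange_big/= mulr_sumr; apply: eq_bigr => r _.
rewrite -mulr_sumr (sum_tuple_prod (fun a j => (tnth x j == tnth r a)%:R)).
rewrite mulrCA; congr (_ * _).
have -> : (n%:R ^+ v)^-1 = \prod_(a < v) n%:R^-1 :> R.
  by rewrite prodr_const card_ord exprVn.
by rewrite -big_split/=; apply: eq_bigr.
Qed.

Definition symmetrized phi (r : v.-tuple (color c)) : R :=
  (v`!)%:R^-1 * \sum_(s : 'S_v) phi (permute_tuple s r).

Lemma symmetrized_le phi K : (forall r, `|phi r| <= K) ->
  forall r, `|symmetrized phi r| <= K.
Proof.
move=> phiK r; rewrite normrM ger0_norm ?invr_ge0//.
rewrite ler_pdivrMl ?ltr0n ?fact_gt0//.
apply: (@le_trans _ _ (\sum_(s : 'S_v) K)).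
  by apply: le_trans (ler_norm_sum _ _ _) _; exact: ler_sum.
by rewrite sumr_const card_Sn mulr_natl.
Qed.

Lemma sum_symmetrized phi n (x : n.-tuple (color c)) :
  \sum_i symmetrized phi (colors x i) = \sum_i phi (colors x i).
Proof.
rewrite -mulr_sumr exchange_big/= (eq_bigr (fun=> \sum_i phi (colors x i))).
  rewrite sumr_const card_Sn -[X in _ * X]mulr_natl mulKf//.
move=> s _; rewrite [RHS](reindex_inj (can_inj (permute_tupleK s)))/=.
apply: eq_bigr => i _; congr phi.
by apply: eq_from_tnth => a; rewrite !tnth_mktuple.
Qed.

End empirical.

Section concentration.
Context {R : realType} {v c : nat}.
Variables (H : rel 'I_v) (n : nat) (p : R).
Hypothesis p01 : 0 <= p <= 1.
Implicit Types (g : {ffun 'I_n * 'I_n -> bool}) (phi : v.-tuple (color c) -> R).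

Definition graph_of g (x y : 'I_n) : bool := (x != y) && g (pair_key x y).

Lemma all_on_copy (i : v.-tuple 'I_n) g : uniq i ->
  all_on (copy_edges H i) g =
  \prod_(ab in edges H) (graph_of g (tnth i ab.1) (tnth i ab.2))%:R :> R.
Proof.
move=> ui; rewrite /all_on /copy_edges big_imset/=; last exact: copy_edges_inj.
apply: eq_bigr => -[a b]; rewrite inE/= => /andP[ab _]; rewrite /graph_of.
suff -> : tnth i a != tnth i b by [].
by move/tuple_uniqP: ui => ui; apply: contraTneq ab => /ui ->; rewrite ltnn.
Qed.

Definition copies_weight (psi : v.-tuple (color c) -> R) (x : n.-tuple (color c))
    (i : v.-tuple 'I_n) : R :=
  (uniq i)%:R * psi (colors x i).

Definition copies psi x g : R :=
  weighted_count (@copy_edges v H n) (copies_weight psi x) g.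

(** Reindexing the tuples by the inverse of each permutation moves the average over ['S_v] from the
    tensor to [phi]. What remains is a weighted count of copies, to which Janson's inequality
    applies. *)
Lemma Nstat_copies phi (x : n.-tuple (color c)) g :
  Nstat (sym_tensor H p (graph_of g)) phi x =
  (n%:R ^+ v * p ^+ #|edges H|)^-1 * copies (symmetrized phi) x g.
Proof.
rewrite /Nstat /copies /weighted_count invfM -!mulrA; congr (_ * _).
rewrite (eq_bigr (fun i : v.-tuple 'I_n => p ^- #|edges H| * ((v`!)%:R^-1 * \sum_(s : 'S_v)
    ((uniq i)%:R * phi (colors x i) * all_on (copy_edges H (permute_tuple s i)) g)))); last first.
  move=> i _; rewrite /sym_tensor invfM mulrAC -!mulrA mulrCA; congr (_ * (_ * _)).
  rewrite mulrC mulr_suml; apply: eq_bigr => s _.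
  have [ui|_] := boolP (uniq i); last by rewrite !mul0r mulr0 mul0r.
  rewrite all_on_copy; last first.
    move/tuple_uniqP: ui => ui; apply/tuple_uniqP => a b.
    by rewrite !tnth_mktuple => /ui/perm_inj.
  rewrite mul1r mulr1 mulrC; congr (_ * _).
  by apply: eq_bigr => ab _; rewrite !tnth_mktuple.
rewrite -mulr_sumr; congr (_ * _).
rewrite -mulr_sumr exchange_big/= mulr_sumr.
rewrite (eq_bigr (fun s => \sum_(j : v.-tuple 'I_n) (v`!)%:R^-1 * ((uniq j)%:R *
    phi (permute_tuple s^-1%g (colors x j)) * all_on (copy_edges H j) g))); last first.
  move=> s _; rewrite -mulr_sumr; congr (_ * _).
  rewrite (reindex_inj (can_inj (permute_tupleK s^-1%g)))/=; apply: eq_bigr => j _.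
  rewrite -{3}(invgK s) permute_tupleK.
  have -> : uniq (permute_tuple s^-1%g j) = uniq j.
    apply/tuple_uniqP/tuple_uniqP => uj a b.
      move=> jab; have := uj (s a) (s b); rewrite !tnth_mktuple !permK.
      by move=> /(_ jab)/perm_inj.
    by rewrite !tnth_mktuple => /uj/perm_inj.
  congr (_ * phi _ * _).
  by apply: eq_from_tnth => a; rewrite !tnth_mktuple.
rewrite exchange_big/=; apply: eq_bigr => j _.
rewrite -mulr_sumr /copies_weight /symmetrized [X in _ = X * _]mulrCA -[RHS]mulrA.
congr (_ * _); rewrite mulr_sumr mulr_suml (reindex_inj invg_inj)/=.
by apply: eq_bigr => s _; rewrite invgK.
Qed.

End concentration.

(** * Uniform concentration *)

Lemma nonuniq_le (R : realType) (n v : nat) : (0 < n)%N ->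
  (n%:R ^+ v)^-1 * \sum_(i : v.-tuple 'I_n) (~~ uniq i)%:R <= (v ^ 2)%:R / n%:R :> R.
Proof.
move=> n0; have nR0 : 0 < (n%:R : R) by rewrite ltr0n.
have uE : \sum_(i : v.-tuple 'I_n) (uniq i)%:R = (n ^_ v)%:R :> R.
  rewrite -natr_sum; congr _%:R.
  rewrite -[X in (X ^_ _)%N]card_ord -card_uniq_tuples -sum1dep_card [RHS]big_mkcond/=.
  apply: eq_bigr => i _; rewrite (_ : all _ _ = true); first by case: (uniq i).
  exact/allP.
have sE : \sum_(i : v.-tuple 'I_n) (~~ uniq i)%:R = n%:R ^+ v - (n ^_ v)%:R :> R.
  rewrite -uE; apply/eqP; rewrite eq_sym subr_eq -big_split/=; apply/eqP.
  rewrite (eq_bigr (fun=> 1)); last by move=> i _; case: (uniq i); rewrite ?addr0 ?add0r.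
  by rewrite sumr_const card_tuple card_ord natrX.
rewrite sE ler_pdivrMl ?exprn_gt0// mulrA ler_pdivlMr//.
have := ffact_lower n v; rewrite -(ler_nat R) natrD !natrM !natrX exprS => h.
by lra.
Qed.

Section concentration_bound.
Context {R : realType} {v c : nat}.
Variables (H : rel 'I_v) (n : nat) (p : R).
Hypotheses (p01 : 0 < p <= 1) (n_gt0 : (0 < n)%N).
Implicit Types (g : {ffun 'I_n * 'I_n -> bool}) (phi : v.-tuple (color c) -> R).

Definition num_copies g : R :=
  weighted_count (@copy_edges v H n) (fun i => (uniq i)%:R) g.

Definition expected_copies phi (x : n.-tuple (color c)) : R :=
  p ^+ #|edges H| * \sum_i copies_weight phi x i.

Definition expected_num_copies : R :=
  p ^+ #|edges H| * \sum_(i : v.-tuple 'I_n) (uniq i)%:R.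

Lemma count_mean_copies (w : v.-tuple 'I_n -> R) :
  (forall i : v.-tuple 'I_n, ~~ uniq i -> w i = 0) ->
  count_mean (pair_prob p) (@copy_edges v H n) w = p ^+ #|edges H| * \sum_i w i.
Proof.
move=> wu; rewrite mulr_sumr; apply: eq_bigr => i _.
have [ui|/wu ->] := boolP (uniq i); last by rewrite mulr0 mul0r.
by rewrite copy_prob// mulrC.
Qed.

Lemma copies_affine (K s : R) phi x g :
  copies H (fun r => K + s * phi r) x g = K * num_copies g + s * copies H phi x g.
Proof.
rewrite /copies /num_copies /weighted_count !mulr_sumr -big_split/=.
by apply: eq_bigr => i _; rewrite /copies_weight; ring.
Qed.

Lemma expected_copies_affine (K s : R) phi x :
  expected_copies (fun r => K + s * phi r) x =
  K * expected_num_copies + s * expected_copies phi x.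
Proof.
rewrite /expected_copies /expected_num_copies !mulr_sumr -big_split/=.
by apply: eq_bigr => i _; rewrite /copies_weight; ring.
Qed.

(* The total count turns the lower tails of the counts weighted by K + phi and
   K - phi into two-sided bounds. *)
Lemma copies_close (K t : R) phi x g : 0 <= K ->
  expected_copies (fun r => K + 1 * phi r) x - t < copies H (fun r => K + 1 * phi r) x g ->
  expected_copies (fun r => K + -1 * phi r) x - t < copies H (fun r => K + -1 * phi r) x g ->
  num_copies g < expected_num_copies + t ->
  `|copies H phi x g - expected_copies phi x| <= (K + 1) * t.
Proof.
move=> K0; rewrite !copies_affine !expected_copies_affine => h1 h2 /ltW h3.
have := ler_wpM2l K0 h3; rewrite ler_norml => h4; apply/andP; split; lra.
Qed.

(** Two errors add up: [d] for the fluctuation of the count, and [K * ((v ^ 2)%:R / n%:R)] for the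
    tuples with repeated entries, which [mean_poly] counts and the tensor does not. *)
Lemma Nstat_close (K d : R) phi x g : (forall r, `|phi r| <= K) ->
  `|copies H (symmetrized phi) x g - expected_copies (symmetrized phi) x| <=
    d * (n%:R ^+ v * p ^+ #|edges H|) ->
  `|Nstat (sym_tensor H p (graph_of g)) phi x - mean_poly phi (empirical x)| <=
    d + K * ((v ^ 2)%:R / n%:R).
Proof.
move=> phiK; have nR0 : 0 < (n%:R : R) by rewrite ltr0n.
have /andP[p0 _] := p01.
set M := n%:R ^+ v * _; have M0 : 0 < M by rewrite mulr_gt0 ?exprn_gt0.
move=> close; rewrite Nstat_copies -/M mean_poly_empirical -sum_symmetrized.
set S := \sum_i _.
have -> : (n%:R ^+ v)^-1 * S = M^-1 * expected_copies (symmetrized phi) x +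
    (n%:R ^+ v)^-1 * \sum_(i : v.-tuple 'I_n)
      (~~ uniq i)%:R * symmetrized phi (colors x i).
  rewrite /M /expected_copies invfM -!mulrA mulKf ?expf_neq0 ?gt_eqF// -mulrDr.
  rewrite -big_split/=; congr (_ * _); apply: eq_bigr => i _.
  by rewrite /copies_weight; case: (uniq i); rewrite /= ?mul1r ?mul0r ?addr0 ?add0r.
rewrite opprD addrA; apply: le_trans (ler_normB _ _) _; apply: lerD.
  rewrite -mulrBr normrM gtr0_norm ?invr_gt0// ler_pdivrMl//.
  by rewrite [M * d]mulrC.
apply: (@le_trans _ _ (K * ((n%:R ^+ v)^-1 *
    \sum_(i : v.-tuple 'I_n) (~~ uniq i)%:R))); last first.
  rewrite ler_wpM2l ?nonuniq_le//.
  by apply: le_trans (phiK [tuple of nseq v ord0]); exact: normr_ge0.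
rewrite normrM gtr0_norm ?invr_gt0 ?exprn_gt0// mulrCA ler_wpM2l ?invr_ge0 ?exprn_ge0//.
rewrite mulr_sumr; apply: le_trans (ler_norm_sum _ _ _) _; apply: ler_sum => i _.
rewrite normrM ger0_norm// mulrC ler_wpM2r// symmetrized_le//.
Qed.

Definition far (eta : R) phi g : bool :=
  ~~ [forall x : n.-tuple (color c),
    `|Nstat (sym_tensor H p (graph_of g)) phi x - mean_poly phi (empirical x)| <= eta].

(** The first term is the union bound over two signs and all colourings, each costing one Janson
    lower tail. The second is a single Chebyshev bound, since the total count does not depend on the
    colouring. *)
Lemma far_prob_le (K L d : R) phi : 0 < K -> 0 < L -> 0 < d -> (0 < v)%N ->
  (forall r, `|phi r| <= K) ->
  (forall F : {set 'I_v}, (2 <= #|F|)%N -> L <= n%:R ^+ #|F| * p ^+ #|edges_in H F|) ->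
  bern_mean (pair_prob p)
    (fun g => (far ((K + 1) * d + K * ((v ^ 2)%:R / n%:R)) phi g)%:R) <=
  2 * (c.-1.+1)%:R ^+ n *
    expR (- (d ^+ 2 * L / (8 * K ^+ 2 * (v%:R ^+ v * 2 ^+ v)))) +
  v%:R ^+ v * 2 ^+ v / (d ^+ 2 * L).
Proof.
move=> K0 L0 d0 v0 phiK FL.
have nR0 : 0 < (n%:R : R) by rewrite ltr0n.
have [/andP[p0 p1]] := p01; have p01' : 0 <= p <= 1 by rewrite ltW.
have q01 := @pair_prob01 R n p p01'.
set M := n%:R ^+ v * p ^+ #|edges H|.
have M0 : 0 < M by rewrite mulr_gt0 ?exprn_gt0.
set C := v%:R ^+ v * 2 ^+ v.
have C0 : 0 < C by rewrite mulr_gt0 ?exprn_gt0 ?ltr0n.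
pose t := d * M; have t0 : 0 < t by rewrite mulr_gt0.
pose low (s : R) x g := (copies H (fun r => K + s * symmetrized phi r) x g <=
   expected_copies (fun r => K + s * symmetrized phi r) x - t)%R.
pose up g := (expected_num_copies + t <= num_copies g)%R.
have bad_le g : (far ((K + 1) * d + K * ((v ^ 2)%:R / n%:R)) phi g)%:R <=
    (\sum_x (low 1 x g)%:R + \sum_x (low (-1) x g)%:R) + (up g)%:R :> R.
  have S0 s : 0 <= \sum_x (low s x g)%:R :> R by apply: sumr_ge0.
  have low1 s x : low s x g -> 1 <= \sum_x (low s x g)%:R :> R.
    by move=> lx; rewrite (bigD1 x)//= lx lerDl sumr_ge0.
  have U0 : 0 <= (up g)%:R :> R by [].
  have [] := boolP (far _ _ _) => [|_]; last by rewrite !addr_ge0.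
  rewrite /far negb_forall => /existsP[x xfar].
  have [/low1 l1|l1] := boolP (low 1 x g).
    by apply: le_trans l1 _; rewrite -addrA lerDl addr_ge0.
  have [/low1 l2|l2] := boolP (low (-1) x g).
    by apply: le_trans l2 _; rewrite -addrA addrCA lerDl addr_ge0.
  have [u|u] := boolP (up g); first by rewrite lerDr addr_ge0.
  exfalso; move/negP: xfar; apply; apply: Nstat_close => //.
  rewrite -mulrA; apply: copies_close; first exact: ltW.
  - by rewrite ltNge.
  - by rewrite ltNge.
  - by rewrite ltNge.
apply: (@le_trans _ _ (bern_mean (pair_prob p) (fun g =>
    (\sum_x (low 1 x g)%:R + \sum_x (low (-1) x g)%:R) + (up g)%:R))).
  exact: bern_mean_le.
rewrite !bern_meanD !bern_mean_sum; apply: lerD; last first.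
  have wu (i : v.-tuple 'I_n) : ~~ uniq i -> (uniq i)%:R = 0 :> R by move/negPf => ->.
  rewrite /up /num_copies /expected_num_copies -count_mean_copies//.
  have wi0 (i : v.-tuple 'I_n) : 0 <= (uniq i)%:R :> R by [].
  have h := count_upper_tail (@copy_edges v H n) q01 wi0 t0.
  apply: le_trans h _.
  rewrite ler_pdivrMr ?exprn_gt0//.
  apply: (@le_trans _ _ (1 ^+ 2 * C * M ^+ 2 / L)).
    by apply: (overlap_mean_le p01') => // i; case: (uniq i); rewrite ler01 lexx.
  rewrite /t le_eqVlt; apply/orP; left; apply/eqP; field.
  by rewrite !gt_eqF.
have tail (s : R) x : `|s| = 1 -> bern_mean (pair_prob p) (fun g => (low s x g)%:R) <=
    expR (- (d ^+ 2 * L / (8 * K ^+ 2 * C))).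
  move=> s1; have psiK r : `|s * symmetrized phi r| <= K.
    by rewrite normrM s1 mul1r symmetrized_le.
  pose w := copies_weight (fun r => K + s * symmetrized phi r) x.
  have wu (i : v.-tuple 'I_n) : ~~ uniq i -> w i = 0.
    by rewrite /w /copies_weight => /negPf ->; rewrite mul0r.
  have w01 i : 0 <= w i <= 2 * K.
    rewrite /w /copies_weight; case: (uniq i); rewrite ?mul0r ?mul1r; last by lra.
    by have := psiK (colors x i); rewrite ler_norml; lra.
  have w0 i : 0 <= w i by case/andP: (w01 i).
  rewrite /low /copies /expected_copies -/w -count_mean_copies//.
  (* The weights lie in [0, 2K]; with t = d M, the quotient t^2 / (2 D) is the exponent d^2 L / (8
     K^2 C). *)
  have D0 : 0 < (2 * K) ^+ 2 * C * M ^+ 2 / L.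
    by rewrite divr_gt0 ?mulr_gt0 ?exprn_gt0 ?mulr_gt0 ?ltr0n.
  apply: le_trans (@janson_lower_tail _ _ _ _ (@copy_edges v H n) _ q01 w0 _ _ (ltW t0) D0 _) _.
    by apply: (overlap_mean_le p01').
  rewrite ler_expR lerN2 /t le_eqVlt; apply/orP; left; apply/eqP; field.
  by rewrite !gt_eqF.
have n1 : `|1| = 1 :> R by rewrite normr1.
have nN1 : `|-1| = 1 :> R by rewrite normrN1.
apply: (@le_trans _ _ (\sum_(x : n.-tuple (color c)) 2 *
    expR (- (d ^+ 2 * L / (8 * K ^+ 2 * C))))).
  rewrite -big_split/=; apply: ler_sum => x _.
  by have := tail 1 x n1; have := tail (-1) x nN1; lra.
rewrite sumr_const card_tuple card_ord -[leLHS]mulr_natl natrX.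
by rewrite mulrCA mulrA.
Qed.

End concentration_bound.

Lemma concentration (R : realType) (v c : nat) (H : rel 'I_v) (p : nat -> R)
    (phi : v.-tuple (color c) -> R) (eta eps : R) :
  (0 < v)%N -> simple_graph H -> (forall n, 0 <= p n <= 1) ->
  much_less (fun n => (n%:R * ln n%:R) `^ (- (two_core_max_degree H)%:R^-1)) p ->
  0 < eta -> 0 < eps ->
  \forall n \near \oo, 0 < p n /\
    bern_mean (pair_prob (p n)) (fun g => (@far R v c H n (p n) eta phi g)%:R) <= eps.
Proof.
move=> v0 Hs p01 plow eta0 eps0.
pose K : R := 1 + \sum_r `|phi r|.
have phiK r : `|phi r| <= K.
  rewrite /K (bigD1 r)//=; have : 0 <= \sum_(i | i != r) `|phi i| by exact: sumr_ge0.
  by lra.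
have K1 : 1 <= K by rewrite /K lerDl sumr_ge0.
have K0 : 0 < K by lra.
pose d := eta / (2 * (K + 1)).
have d0 : 0 < d by rewrite divr_gt0// mulr_gt0//; lra.
pose C : R := v%:R ^+ v * 2 ^+ v.
have C0 : 0 < C by rewrite mulr_gt0 ?exprn_gt0 ?ltr0n.
pose a := d ^+ 2 / (8 * K ^+ 2 * C).
have a0 : 0 < a.
  apply: divr_gt0; first exact: exprn_gt0.
  by apply: mulr_gt0 => //; apply: mulr_gt0 => //; exact: exprn_gt0.
(* Chosen so that the Janson exponent [a * K' * n%:R] is (ln c + 1) n: the factor c^n of the union
   bound cancels and exp(-n) is left. *)
pose K' := (ln (c.-1.+1)%:R + 1) / a.
have K'0 : 0 < K'.
  by rewrite divr_gt0// ltr_wpDl// ln_ge0// ler1n.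
near=> n.
have nR0 : 0 < (n%:R : R) by rewrite ltr0n; near: n; exact: nbhs_infty_gt.
have [pn0 dense] : 0 < p n /\ forall F : {set 'I_v}, (2 <= #|F|)%N ->
      K' * n%:R <= n%:R ^+ #|F| * p n ^+ #|edges_in H F|.
  by near: n; exact: eventually_dense.
split=> //.
have pn : 0 < p n <= 1 by rewrite pn0; case/andP: (p01 n).
have p01n : 0 <= p n <= 1 by [].
apply: (@le_trans _ _ (bern_mean (pair_prob (p n)) (fun g =>
    (@far R v c H n (p n) ((K + 1) * d + K * ((v ^ 2)%:R / n%:R)) phi g)%:R))).
  apply: bern_mean_le; first exact: pair_prob01.
  move=> g; rewrite ler_nat; case: (boolP (far H (p n) eta phi g)) => // h.
  rewrite (_ : far _ _ _ _ _ = true)//; apply: contra h => /forallP h.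
  apply/forallP => x; apply: le_trans (h x) _.
  have -> : (K + 1) * d = eta / 2 by rewrite /d; field; lra.
  have : K * ((v ^ 2)%:R / n%:R) <= eta / 2.
    rewrite mulrA ler_pdivrMr// -ler_pdivrMl ?divr_gt0//.
    by near: n; exact: nbhs_infty_ger.
  by lra.
have n0 : (0 < n)%N by rewrite -(ltr_nat R).
apply: le_trans (far_prob_le pn n0 K0 (mulr_gt0 K'0 nR0) d0 v0 phiK dense) _.
rewrite -/C.
have -> : d ^+ 2 * (K' * n%:R) / (8 * K ^+ 2 * C) = a * K' * n%:R by rewrite /a; field; rewrite !gt_eqF.
have -> : a * K' = ln (c.-1.+1)%:R + 1 by rewrite /K' mulrC divfK ?gt_eqF.
have -> : - ((ln (c.-1.+1)%:R + 1) * n%:R) = - (ln ((c.-1.+1)%:R ^+ n)) - n%:R :> R.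
  by rewrite lnXn ?ltr0n// -mulr_natr; ring.
rewrite expRD expRN lnK ?posrE ?exprn_gt0 ?ltr0n//.
rewrite mulrA mulfK ?expf_neq0 ?pnatr_eq0//.
have en : expR (- n%:R) <= n%:R^-1 :> R.
  rewrite expRN lef_pV2 ?posrE ?expR_gt0//.
  by apply: le_trans (expR_ge1Dx _); rewrite lerDr.
have -> : C / (d ^+ 2 * (K' * n%:R)) = C / (d ^+ 2 * K') / n%:R.
  by field; rewrite !gt_eqF.
apply: (@le_trans _ _ ((2 + C / (d ^+ 2 * K')) / n%:R)); first by lra.
rewrite ler_pdivrMr// -ler_pdivrMl//.
by near: n; exact: nbhs_infty_ger.
Unshelve. all: by end_near. Qed.

(** * The law of the random graph *)

Section finite_preimage.
Context d (Omega : measurableType d) (R : realType) (T : finType).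
Variables (mu : {measure set Omega -> \bar R}) (Y : Omega -> T).
Hypothesis mY : forall t, measurable [set w | Y w = t].

Lemma finite_preimageE (B : pred T) :
  [set w | B (Y w)] = \bigcup_(t in [set` B]) [set w | Y w = t].
Proof.
apply/seteqP; split=> [w Bw|w [t Bt wt]]; first by exists (Y w).
by rewrite /= (_ : Y w = t).
Qed.

Lemma measure_finite_preimage (B : pred T) :
  mu [set w | B (Y w)] = (\sum_(t | B t) mu [set w | Y w = t])%E.
Proof.
rewrite finite_preimageE measure_fin_bigcup//.
  by rewrite -(@bigfs _ _ _ _ (index_enum T)) ?index_enum_uniq// => t _; rewrite mem_index_enum.
by move=> t t' _ _ [w [/= -> ->]].
Qed.

End finite_preimage.

Section erdos_renyi_law.
Context d (Omega : measurableType d) (R : realType) (P : probability Omega R).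
Variables (n : nat) (p : R) (G : 'I_n -> 'I_n -> {RV P >-> bool}).
Hypotheses (p01 : 0 <= p <= 1) (G_er : erdos_renyi p G).

Definition graph_code (w : Omega) : {ffun 'I_n * 'I_n -> bool} :=
  [ffun xy : 'I_n * 'I_n => (xy.1 < xy.2)%N && G xy.1 xy.2 w].

Lemma graph_codeE w x y : G x y w = graph_of (graph_code w) x y.
Proof.
have [_ _ symG G0] := G_er.
rewrite /graph_of /pair_key; have [->|xy] := eqVneq x y; first by rewrite G0.
rewrite ffunE; case: (ltnP x y) => [xy'|yx] /=; first by rewrite xy'.
have yx' : (y < x)%N by rewrite ltn_neqAle yx andbT eq_sym.
by rewrite yx' symG.
Qed.

Lemma graph_code_event (g : {ffun 'I_n * 'I_n -> bool}) :
  [set w | graph_code w = g] = \bigcap_xy [set w | graph_code w xy = g xy].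
Proof.
apply/seteqP; split=> [w <- //|w h]; apply/ffunP => xy; exact: h.
Qed.

Lemma measurable_graph_code g : measurable [set w | graph_code w = g].
Proof.
rewrite graph_code_event; apply: fin_bigcap_measurable => [|xy _]; first exact: finite_finset.
rewrite (_ : [set w | _] =
    [set w | (xy.1 < xy.2)%N && G xy.1 xy.2 w == g xy]); last first.
  by apply/seteqP; split=> w /=; rewrite ffunE => /eqP.
case: (xy.1 < xy.2)%N => /=.
  rewrite (_ : [set w | _] = G xy.1 xy.2 @^-1` [set g xy]).
    by rewrite -[X in measurable X]setTI; exact: measurable_funP.
  by apply/seteqP; split=> w /= /eqP.
case: (g xy).
  have -> : [set w : Omega | false == true] = set0 by apply/seteqP; split.
  exact: measurable0.
have -> : [set w : Omega | false == false] = setT by apply/seteqP; split.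
exact: measurableT.
Qed.

Lemma graph_code_prob g : P [set w | graph_code w = g] = (bern_weight (pair_prob p) g)%:E.
Proof.
have [G_law G_ind _ _] := G_er.
have [bad|] := boolP [exists xy : 'I_n * 'I_n, g xy && ~~ (xy.1 < xy.2)%N].
  have /existsP[xy /andP[gxy nxy]] := bad.
  rewrite (_ : [set w | _] = set0) ?measure0; last first.
    apply/seteqP; split=> // w /= wg; move: gxy; rewrite -wg ffunE.
    by rewrite (negPf nxy).
  by rewrite /bern_weight (bigD1 xy)//= gxy /pair_prob (negPf nxy) mul0r.
rewrite negb_exists => /forallP good.
pose D : {set 'I_n * 'I_n} := [set ij : 'I_n * 'I_n | (ij.1 < ij.2)%N]%SET.
rewrite (_ : [set w | _] = \bigcap_(xy in [set` D]) (G xy.1 xy.2) @^-1` [set g xy]).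
  rewrite (G_ind D (fun xy => [set g xy]))//.
  rewrite /bern_weight [in RHS](bigID (mem D))/= [X in _ = (_ * X)%:E]big1 ?mulr1; last first.
    move=> xy; rewrite inE => nxy; have := good xy; rewrite nxy andbT => /negPf ->.
    by rewrite /pair_prob (negPf nxy) subr0.
  rewrite -prodEFin; apply: eq_bigr => xy; rewrite inE => lxy.
  have := G_law _ _ lxy [set g xy]; rewrite /distribution /pushforward => ->.
  rewrite bernoulli_probE// !diracE /pair_prob lxy; case: (g xy).
    by rewrite mem_set// memNset//= mule1 mule0 adde0.
  by rewrite memNset// mem_set//= mule1 mule0 add0e.
apply/seteqP; split=> [w <- xy /=|w h].
  by rewrite inE => lxy; rewrite ffunE lxy.
apply/ffunP => xy; rewrite ffunE; have := good xy.
have [lxy _|_] := boolP (xy.1 < xy.2)%N; last by rewrite andbT => /negPf ->.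
by apply: h; rewrite /= inE.
Qed.

(** The bridge from the sample space to the finite sums: any event expressed through the code of the
    graph has a [bern_mean] as its probability. *)
Lemma graph_event_prob (B : pred {ffun 'I_n * 'I_n -> bool}) :
  P [set w | B (graph_code w)] =
  (bern_mean (pair_prob p) (fun g => (B g)%:R))%:E.
Proof.
rewrite (measure_finite_preimage P measurable_graph_code).
rewrite /bern_mean [in RHS](bigID B)/= [X in (_ + X)%:E]big1 ?addr0; last first.
  by move=> g /negPf ->; rewrite mulr0.
by rewrite -sumEFin; apply: eq_bigr => g Bg; rewrite graph_code_prob Bg mulr1.
Qed.

End erdos_renyi_law.

(** * Types of colourings *)

Section types.
Context {R : realType} {c : nat}.
Implicit Types (nu m : color c -> R).

Definition in_simplex nu := (forall r, 0 <= nu r) /\ \sum_r nu r = 1.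

Definition rel_entropy m nu : R := \sum_r nu r * ln (nu r / m r).

Definition iid_weight m n (x : n.-tuple (color c)) : R := \prod_(i < n) m (tnth x i).

Lemma iid_weight_ge0 m n (x : n.-tuple (color c)) :
  (forall r, 0 <= m r) -> 0 <= iid_weight m x.
Proof. by move=> m0; apply: prodr_ge0. Qed.

Lemma sum_iid_weight m n : \sum_r m r = 1 ->
  \sum_(x : n.-tuple (color c)) iid_weight m x = 1.
Proof. by move=> m1; rewrite (sum_tuple_prod (fun _ => m)) big1. Qed.

Lemma sum_colors n (x : n.-tuple (color c)) (F : color c -> R) :
  \sum_(i < n) F (tnth x i) = n%:R * \sum_r empirical x r * F r.
Proof.
case: n x => [|n] x; first by rewrite big_ord0 mul0r.
rewrite mulr_sumr (eq_bigr (fun i : 'I_n.+1 => \sum_r (tnth x i == r)%:R * F r)); last first.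
  move=> i _; rewrite (bigD1 (tnth x i))//= eqxx mul1r big1 ?addr0// => r.
  by rewrite eq_sym => /negPf ->; rewrite mul0r.
rewrite exchange_big/=; apply: eq_bigr => r _.
by rewrite -mulr_suml /empirical !mulrA mulfV ?mul1r// pnatr_eq0.
Qed.

Lemma empirical_simplex n (x : n.-tuple (color c)) : (0 < n)%N ->
  in_simplex (empirical x).
Proof.
move=> n0; split=> [r|]; first by rewrite mulr_ge0 ?invr_ge0// sumr_ge0.
have := sum_colors x (fun=> 1); rewrite sumr_const card_ord.
under [in RHS]eq_bigr do rewrite mulr1.
by rewrite -mulr_natl mulr1 => /esym/(canRL (mulKf _)) ->; rewrite ?mulVf// pnatr_eq0 -lt0n.
Qed.

Lemma empirical_gt0 n (x : n.-tuple (color c)) i :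
  0 < empirical x (tnth x i) :> R.
Proof.
have n0 : (0 < n)%N by case: n x i => // x [].
apply: mulr_gt0; first by rewrite invr_gt0 ltr0n.
by rewrite (bigD1 i)//= eqxx ltr_pwDl// sumr_ge0.
Qed.

(** The density of one product law with respect to another depends on [x] only through its empirical
    measure. Positivity of [nu] is asked only at the colours of [x], so that [nu] may be the
    empirical measure itself. *)
Lemma iid_weight_tilt m nu n (x : n.-tuple (color c)) :
  (forall r, 0 < m r) -> (forall i, 0 < nu (tnth x i)) ->
  iid_weight m x = iid_weight nu x *
    expR (- (n%:R * \sum_r empirical x r * ln (nu r / m r))).
Proof.
move=> m0 nu0; rewrite -sum_colors -sumrN expR_sum -big_split/=.
apply: eq_bigr => i _; rewrite expRN lnK ?posrE ?divr_gt0//.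
by rewrite invf_div mulrCA mulfV ?mulr1// gt_eqF.
Qed.

(** Method of types: tilting to the type of [x] produces the relative entropy factor, each type
    class has mass at most 1 under its own type, and there are at most (n+1)^c types. A general [h]
    serves both the probabilities, as an indicator, and the free energy, as an exponential. *)
Lemma sum_by_type m n (h : n.-tuple (color c) -> R) (B : R) : (0 < n)%N ->
  (forall r, 0 < m r) -> 0 <= B ->
  (forall x, h x * expR (- (n%:R * rel_entropy m (empirical x))) <= B) ->
  \sum_x iid_weight m x * h x <= (n.+1)%:R ^+ c.-1.+1 * B.
Proof.
move=> n0 m0 B0 hB.
(* Types are recorded as integer counts to have a finite set to sum over; [inord] loses nothing
   because counts are at most [n]. *)
pose cnt (x : n.-tuple (color c)) : {ffun color c -> 'I_n.+1} :=
  [ffun r => inord (\sum_(i < n) (tnth x i == r))].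
pose fr (k : {ffun color c -> 'I_n.+1}) (r : color c) : R := n%:R^-1 * (k r)%:R.
have frE x r : fr (cnt x) r = empirical x r.
  rewrite /fr ffunE inordK; first by rewrite natr_sum.
  rewrite ltnS -[X in (_ <= X)%N]card_ord -sum1_card; apply: leq_sum => i _.
  exact: leq_b1.
have stepx x : iid_weight m x * h x <= B * iid_weight (fr (cnt x)) x.
  have -> : iid_weight (fr (cnt x)) x = iid_weight (empirical x) x.
    by apply: eq_bigr => i _; rewrite frE.
  rewrite (@iid_weight_tilt m (empirical x))//; last by move=> i; exact: empirical_gt0.
  have w0 : 0 <= iid_weight (empirical x) x.
    by apply: iid_weight_ge0; case: (empirical_simplex x n0).
  have := ler_wpM2r w0 (hB x); rewrite /rel_entropy; congr (_ <= _).
  by rewrite [RHS]mulrAC -[RHS]mulrA [RHS]mulrC.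
apply: (@le_trans _ _ (\sum_x B * iid_weight (fr (cnt x)) x)); first exact: ler_sum.
rewrite -mulr_sumr mulrC ler_wpM2r//.
rewrite (partition_big cnt xpredT)//=.
apply: (@le_trans _ _ (\sum_(k : {ffun color c -> 'I_n.+1}) 1)); last first.
  by rewrite sumr_const card_ffun !card_ord -natrX.
apply: ler_sum => k _.
have [[x0 x0k]|nok] := pselect (exists x, cnt x == k); last first.
  rewrite big_pred0// => x; apply/negbTE/negP => xk; apply: nok; by exists x.
have [fr0 fr1] : in_simplex (fr k).
  have [e0 e1] := empirical_simplex x0 n0; rewrite -(eqP x0k); split=> [r|].
    by rewrite frE.
  by under eq_bigr do rewrite frE.
rewrite -(sum_iid_weight n fr1) [leRHS](bigID (fun x => cnt x == k))/=.
rewrite (eq_bigr (fun x => iid_weight (fr k) x)); last by move=> x /eqP <-.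
by rewrite lerDl sumr_ge0// => x _; exact: iid_weight_ge0.
Qed.

Lemma iid_covariance nu n (i j : 'I_n) (a : color c -> R) :
  \sum_r nu r = 1 -> \sum_r nu r * a r = 0 ->
  \sum_(x : n.-tuple (color c)) iid_weight nu x * (a (tnth x i) * a (tnth x j)) =
  (i == j)%:R * \sum_r nu r * a r ^+ 2.
Proof.
move=> nu1 nua.
pose F k r := nu r * ((if k == i then a r else 1) * (if k == j then a r else 1)).
rewrite (eq_bigr (fun x => \prod_k F k (tnth x k))); last first.
  move=> x _; rewrite /F !big_split/= -!big_mkcond/= !big_pred1_eq//.
rewrite sum_tuple_prod (bigD1 i)//= /F eqxx; case: eqVneq => [->|ij].
  rewrite mul1r [X in _ * X]big1 ?mulr1; first by apply: eq_bigr => r _; rewrite expr2.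
  by move=> k /negPf ->; rewrite -[RHS]nu1; apply: eq_bigr => r _; rewrite !mulr1.
by rewrite mul0r (eq_bigr (fun r => nu r * a r)) ?nua ?mul0r// => r _; rewrite mulr1.
Qed.

(** The exact value carries a further factor [1 - nu r]. The bound without it sums over [r] to 1 /
    n, so the union bound over colours costs no factor. *)
Lemma empirical_variance nu n (r : color c) : (0 < n)%N -> in_simplex nu ->
  \sum_(x : n.-tuple (color c)) iid_weight nu x * (empirical x r - nu r) ^+ 2 <=
  nu r / n%:R.
Proof.
move=> n0 [nu0 nu1]; have nR0 : 0 < (n%:R : R) by rewrite ltr0n.
pose a t : R := (t == r)%:R - nu r.
have s1 : \sum_t nu t * (t == r)%:R = nu r.
  by rewrite (bigD1 r)//= eqxx mulr1 big1 ?addr0// => t /negPf ->; rewrite mulr0.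
have nua : \sum_t nu t * a t = 0.
  rewrite /a; under eq_bigr do rewrite mulrBr.
  by rewrite sumrB -mulr_suml nu1 mul1r s1 subrr.
have nua2 : \sum_t nu t * a t ^+ 2 <= nu r.
  rewrite (eq_bigr (fun t => nu t * (t == r)%:R * (1 - nu r) - nu r * (nu t * a t))).
    rewrite sumrB -mulr_suml s1 -mulr_sumr nua mulr0 subr0.
    by rewrite ler_piMr// gerDl oppr_le0.
  by move=> t _; rewrite /a; case: (t == r) => /=; ring.
rewrite (eq_bigr (fun x => n%:R ^- 2 * \sum_(i < n) \sum_(j < n)
    iid_weight nu x * (a (tnth x i) * a (tnth x j)))); last first.
  move=> x _; have -> : empirical x r - nu r = n%:R^-1 * \sum_(i < n) a (tnth x i).
    rewrite /a sumrB mulrBr sumr_const card_ord -[nu r *+ n]mulr_natl mulrA mulVf ?gt_eqF//.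
    by rewrite mul1r.
  rewrite exprMn exprVn mulrCA; congr (_ * _).
  rewrite expr2 mulr_suml mulr_sumr; apply: eq_bigr => i _.
  by rewrite mulr_sumr mulr_sumr.
rewrite -mulr_sumr exchange_big/= (eq_bigr (fun i => \sum_t nu t * a t ^+ 2)); last first.
  move=> i _; rewrite exchange_big/= (bigD1 i)//= iid_covariance// eqxx mul1r.
  by rewrite [X in _ + X]big1 ?addr0// => j ji; rewrite iid_covariance// eq_sym (negPf ji) mul0r.
rewrite sumr_const card_ord -[X in _ * X]mulr_natr.
rewrite ler_pdivrMl ?exprn_gt0//.
apply: (@le_trans _ _ (nu r * n%:R)); first by rewrite ler_wpM2r.
by rewrite le_eqVlt; apply/orP; left; apply/eqP; field; rewrite gt_eqF.
Qed.

Lemma empirical_concentration nu n (d : R) : (0 < n)%N -> in_simplex nu -> 0 < d ->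
  1 - (n%:R * d ^+ 2)^-1 <=
  \sum_(x : n.-tuple (color c) | [forall r, `|empirical x r - nu r| < d]) iid_weight nu x.
Proof.
move=> n0 nuS d0; have [nu0 nu1] := nuS; have nR0 : 0 < (n%:R : R) by rewrite ltr0n.
rewrite lerBlDr -[leLHS](sum_iid_weight n nu1)
  (bigID (fun x : n.-tuple _ => [forall r, `|empirical x r - nu r| < d]))/= lerD2l.
apply: (@le_trans _ _ (\sum_r \sum_(x : n.-tuple (color c))
    d ^- 2 * (iid_weight nu x * (empirical x r - nu r) ^+ 2))).
  rewrite exchange_big/= [leLHS]big_mkcond/=; apply: ler_sum => x _.
  have w0 : 0 <= iid_weight nu x by exact: iid_weight_ge0.
  have t0 r : 0 <= d ^- 2 * (iid_weight nu x * (empirical x r - nu r) ^+ 2).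
    by rewrite mulr_ge0 ?invr_ge0 ?exprn_ge0 ?(ltW d0)// mulr_ge0// sqr_ge0.
  case: ifPn => [|_]; last exact: sumr_ge0.
  rewrite negb_forall => /existsP[r]; rewrite -leNgt => rd.
  rewrite (bigD1 r)//= -[leLHS]addr0 lerD ?sumr_ge0//.
  rewrite ler_pdivlMl ?exprn_gt0// mulrC ler_wpM2l// -[leRHS]real_normK ?num_real//.
  by rewrite ler_pXn2r ?nnegrE ?(ltW d0).
apply: (@le_trans _ _ (\sum_r d ^- 2 * (nu r / n%:R))).
  apply: ler_sum => r _; rewrite -mulr_sumr ler_wpM2l ?invr_ge0 ?exprn_ge0 ?(ltW d0)//.
  exact: empirical_variance.
by rewrite -mulr_sumr -mulr_suml nu1 mul1r [leRHS]invfM [leLHS]mulrC.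
Qed.

(** Tilt to [nu], under which the empirical measure is [d]-close to [nu] with probability at least
    1/2. On that event the exponent is off by at most [d * A <= eta / 2]; the other [eta / 2]
    absorbs the factor 1/2 for large [n]. *)
Lemma type_lower_bound m nu (eta : R) : (forall r, 0 < m r) -> in_simplex nu -> 0 < eta ->
  \forall n \near \oo, expR (- (n%:R * (rel_entropy m nu + eta))) <=
    \sum_(x : n.-tuple (color c) | [forall r, `|empirical x r - nu r| < eta]) iid_weight m x.
Proof.
move=> m0 nuS eta0; have [nu0 nu1] := nuS.
pose A : R := \sum_r `|ln (nu r / m r)|.
have A0 : 0 <= A by exact: sumr_ge0.
pose d := Num.min eta (eta / (2 * (A + 1))).
have d0 : 0 < d by rewrite lt_min eta0 divr_gt0// mulr_gt0// ltr_wpDl.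
have dA : d * A <= eta / 2.
  apply: (@le_trans _ _ (eta / (2 * (A + 1)) * A)).
    by rewrite ler_wpM2r// ge_min lexx orbT.
  rewrite mulrAC ler_pdivrMr ?mulr_gt0 ?ltr_wpDl//.
  have -> : eta / 2 * (2 * (A + 1)) = eta * (A + 1) by field.
  by rewrite ler_wpM2l ?(ltW eta0)// lerDl.
near=> n.
have nR0 : 0 < (n%:R : R) by rewrite ltr0n; near: n; exact: nbhs_infty_gt.
have n0 : (0 < n)%N by rewrite -(ltr_nat R).
have mn0 : forall r, 0 <= m r by move=> r; exact: ltW.
apply: (@le_trans _ _ (\sum_(x : n.-tuple (color c) | [forall r, `|empirical x r - nu r| < d])
    expR (- (n%:R * (rel_entropy m nu + eta / 2))) * iid_weight nu x)); last first.
  rewrite [leLHS]big_mkcond [leRHS]big_mkcond/=; apply: ler_sum => x _.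
  case: ifPn => [/forallP xd|_]; last by case: ifP => // _; exact: iid_weight_ge0.
  rewrite ifT; last first.
    by apply/forallP => r; rewrite (lt_le_trans (xd r))// ge_min lexx.
  (* A colouring that uses a colour of zero [nu]-mass cannot be tilted, but its [nu]-weight is 0. *)
  have [[i nui]|pos] := pselect (exists i, nu (tnth x i) = 0).
    by rewrite {1}/iid_weight (bigD1 i)//= nui mul0r mulr0 iid_weight_ge0.
  have posi i : 0 < nu (tnth x i).
    by rewrite lt_neqAle nu0 andbT; apply/eqP => e; apply: pos; exists i.
  rewrite (iid_weight_tilt m0 posi) mulrC ler_wpM2l ?iid_weight_ge0// ler_expR lerN2.
  rewrite ler_wpM2l ?(ltW nR0)// -lerBlDl /rel_entropy -sumrB.
  apply: le_trans dA; rewrite mulr_sumr; apply: ler_sum => r _.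
  rewrite -mulrBl; apply: le_trans (ler_norm _) _; rewrite normrM ler_wpM2r//.
  exact: ltW.
rewrite -mulr_sumr.
have half : 2^-1 <= \sum_(x : n.-tuple (color c) | [forall r, `|empirical x r - nu r| < d])
    iid_weight nu x.
  apply: le_trans (empirical_concentration n0 nuS d0).
  have : (n%:R * d ^+ 2)^-1 <= 2^-1.
    rewrite lef_pV2 ?posrE ?mulr_gt0 ?exprn_gt0// -ler_pdivrMr ?exprn_gt0//.
    by near: n; exact: nbhs_infty_ger.
  by lra.
apply: (@le_trans _ _ (expR (- (n%:R * (rel_entropy m nu + eta / 2))) * 2^-1)); last first.
  by rewrite ler_wpM2l ?expR_ge0.
have -> : - (n%:R * (rel_entropy m nu + eta)) =
   - (n%:R * (rel_entropy m nu + eta / 2)) - n%:R * eta / 2 by field.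
rewrite expRD ler_wpM2l ?expR_ge0// expRN lef_pV2 ?posrE ?expR_gt0//.
apply: le_trans (expR_ge1Dx _).
have : 2 / eta <= n%:R by near: n; exact: nbhs_infty_ger.
rewrite ler_pdivrMr//; lra.
Unshelve. all: by end_near. Qed.

End types.

(** * Functionals of fractional colourings *)

Section tuple_prob_integral.
Context d (T : measurableType d) (R : realType) (P : probability T R).

Lemma measurable_tuple_prod n (h : 'I_n -> T -> R) :
  (forall a, measurable_fun setT (h a)) ->
  measurable_fun setT (fun t : n.-tuple T => \prod_(a < n) h a (tnth t a)).
Proof.
move=> mh; apply: measurable_prod => a _.
by apply: measurableT_comp => //; exact: measurable_tnth.
Qed.

Lemma integral_tuple_prob n (h : 'I_n -> T -> R) :
  (forall a, measurable_fun setT (h a)) -> (forall a x, 0 <= h a x) ->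
  (\int[tuple_prob P n]_t (\prod_(a < n) h a (tnth t a))%:E =
   \prod_(a < n) \int[P]_x (h a x)%:E)%E.
Proof.
elim: n h => [|n IH] h mh h0.
  rewrite big_ord0 /=; under eq_integral do rewrite big_ord0.
  by rewrite integral_cst//= diracT mul1e.
rewrite big_ord_recl -IH//=.
rewrite ge0_integral_distribution; last 2 first.
- by apply/measurable_EFinP; exact: measurable_tuple_prod.
- by move=> t; rewrite lee_fin prodr_ge0.
pose F x := (\prod_(a < n) h (lift ord0 a) (tnth x a)).
have F0 x : 0 <= F x by rewrite prodr_ge0.
have mF : measurable_fun setT F.
  by apply: (@measurable_tuple_prod n (fun a => h (lift ord0 a))).
rewrite (eq_integral (fun z : T * n.-tuple T => (h ord0 z.1 * F z.2)%:E)); last first.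
  move=> [x t] _ /=; rewrite big_ord_recl; congr (_ * _)%:E.
  by apply: eq_bigr => a _; rewrite tnthS.
rewrite fubini_tonelli1//=; last 2 first.
- apply/measurable_EFinP; apply: measurable_funM.
    by apply: measurableT_comp => //; exact: measurable_fst.
  by apply: measurableT_comp => //; exact: measurable_snd.
- by move=> z; rewrite lee_fin mulr_ge0.
rewrite /fubini_F /=.
under eq_integral => x _.
  under eq_integral => t _ do rewrite EFinM.
  rewrite ge0_integralZl//; last 3 first.
  - exact/measurable_EFinP.
  - by move=> t _; rewrite lee_fin.
  - by rewrite lee_fin.
  over.
rewrite ge0_integralZr//.
- exact/measurable_EFinP.
- by move=> x _; rewrite lee_fin.
- by apply: integral_ge0 => t _; rewrite lee_fin.
Qed.

End tuple_prob_integral.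

Section unit_interval.
Context {R : realType}.
Implicit Types (h : R -> R).

Let I01 : set R := `[0, 1].

Lemma measurable_I01 : measurable (I01 : set (measurableTypeR R)).
Proof. exact: measurable_itv. Qed.

Lemma lebesgue_I01 : (@lebesgue_measure R I01 = 1)%E.
Proof. by rewrite lebesgue_measure_itv/= lte_fin ltr01 -EFinD subr0. Qed.

Lemma integrable_I01 h (M : R) : measurable_fun I01 h ->
  (forall x, I01 x -> `|h x| <= M) ->
  (@lebesgue_measure R).-integrable I01 (EFin \o h).
Proof.
move=> mh hM; apply: measurable_bounded_integrable => //.
- exact: measurable_I01.
- by rewrite /= lebesgue_I01 ltry.
- exists M; split; first exact: num_real.
  by move=> y My x /hM /le_trans; apply; exact: ltW.
Qed.

Lemma Rintegral_I01_cst (k : R) : \int[lebesgue_measure]_(x in I01) k = k.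
Proof. by rewrite Rintegral_cst; [rewrite /= lebesgue_I01/= mulr1|exact: measurable_I01]. Qed.

End unit_interval.

Section functionals_on_simplex.
Context {R : realType} {v c : nat}.
Implicit Types (f : color c -> R -> R) (nu : color c -> R).

Definition average f (r : color c) : R := \int[lebesgue_measure]_(u in `[0, 1]) f r u.

Lemma Fc_bound f r (u : R) : Fc f -> u \in `[0, 1] -> 0 <= f r u <= 1.
Proof. by move=> [_ f01 _] u01; have := f01 r u u01; rewrite in_itv. Qed.

Lemma Fc_integrable f r : Fc f ->
  (@lebesgue_measure R).-integrable (`[0, 1] : set R) (EFin \o f r).
Proof.
move=> Ff; have [mf _ _] := Ff; apply: (@integrable_I01 _ _ 1) => // u u01.
by have /andP[f0 f1] := Fc_bound r Ff u01; rewrite ger0_norm.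
Qed.

Lemma average_simplex f : Fc f -> in_simplex (average f).
Proof.
move=> Ff; have [mf _ fsum] := Ff; split=> [r|].
  apply: Rintegral_ge0 => u u01.
  by have /andP[] := Fc_bound r Ff u01.
rewrite /average /Rintegral; apply: EFin_inj; rewrite -sumEFin.
under eq_bigr => r _.
  rewrite fineK; last first.
    by apply: integrable_fin_num; [exact: measurable_I01|exact: Fc_integrable].
  over.
rewrite -integral_sum; [|exact: measurable_I01|by move=> r; exact: Fc_integrable].
rewrite (eq_integral (fun=> 1%E)); last first.
  by move=> u /set_mem u01; rewrite sumEFin fsum.
by rewrite integral_cst; [rewrite /= mul1e lebesgue_I01|exact: measurable_I01].
Qed.

(** With W = 1 the integrand is a combination of products of functions of one variable each, so by
    Tonelli [f] enters only through its averages. This reduces F_c to the simplex. *)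
Lemma Gfun_average (phi : v.-tuple (color c) -> R) f : Fc f ->
  Gfun (fun=> 1) phi f = mean_poly phi (average f).
Proof.
move=> Ff; have [mf _ _] := Ff.
(* [f] is unconstrained outside [0, 1], whereas [integral_tuple_prob] requires functions measurable
   and nonnegative everywhere; extending by 0 also encodes the restriction to the cube. *)
pose h r : measurableTypeR R -> R := f r \_ (`[0, 1] : set R).
have h01 r x : 0 <= h r x <= 1.
  rewrite /h patchE; case: ifPn => [xI|_]; last by rewrite lexx ler01.
  by apply: Fc_bound => //; exact: set_mem.
have mh r : measurable_fun setT (h r).
  exact: (measurable_restrictT (f r) (@measurable_I01 R)).1 (mf r).
have mprod (r : v.-tuple (color c)) : measurable_fun setT
    (fun x : v.-tuple (measurableTypeR R) => \prod_(a < v) h (tnth r a) (tnth x a)).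
  by apply: (@measurable_tuple_prod _ _ _ v (fun a => h (tnth r a))).
have prod01 (r : v.-tuple (color c)) (x : v.-tuple (measurableTypeR R)) :
    0 <= \prod_(a < v) h (tnth r a) (tnth x a) <= 1.
  apply/andP; split; first by apply: prodr_ge0 => a _; case/andP: (h01 (tnth r a) (tnth x a)).
  by apply: prodr_ile1 => a _; exact: h01.
rewrite /Gfun Rintegral_mkcond /Rintegral.
rewrite (eq_integral (fun x => \sum_(r : v.-tuple (color c))
    (phi r * \prod_(a < v) h (tnth r a) (tnth x a))%:E)%E); last first.
  move=> x _; rewrite sumEFin patchE; congr EFin; case: ifPn => [/set_mem xc|xnc].
    rewrite mul1r; apply: eq_bigr => r _; congr (_ * _); apply: eq_bigr => a _.
    by rewrite /h patchE mem_set//; exact: xc.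
  rewrite big1// => r _; apply/eqP; rewrite mulf_eq0; apply/orP; right.
  have [a xa] : exists a, (tnth x a : R) \notin `[0, 1].
    apply: contrapT => /forallNP xin; move/negP: xnc; apply; apply/mem_set => a.
    by apply/negPn/negP; exact: xin.
  rewrite (bigD1 a)//= /h patchE memNset ?mul0r//.
  by move=> /= xa'; rewrite xa' in xa.
rewrite integral_sum//; last first.
  move=> r; apply: (@measurable_bounded_integrable _ _ _ _
    (fun x => phi r * \prod_(a < v) h (tnth r a) (tnth x a))) => //.
  - exact: (le_lt_trans (probability_le1 _ measurableT) (ltry 1)).
  - by apply: measurable_funM.
  - exists `|phi r|; split; first exact: num_real.
    move=> y ylt x _ /=; apply: le_trans (ltW ylt); rewrite normrM ler_piMr//.
    by have /andP[p0 p1] := prod01 r x; rewrite ger0_norm.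
rewrite -[RHS]/(fine (mean_poly phi (average f))%:E); congr fine.
rewrite /mean_poly -sumEFin; apply: eq_bigr => r _.
under eq_integral do rewrite EFinM.
rewrite integralZl//; last first.
  apply: measurable_bounded_integrable => //.
  - exact: (le_lt_trans (probability_le1 _ measurableT) (ltry 1)).
  - exists 1; split; first exact: num_real.
    move=> y ylt x _ /=; apply: le_trans (ltW ylt).
    by have /andP[p0 p1] := prod01 r x; rewrite ger0_norm.
rewrite EFinM; congr (_ * _)%E.
rewrite (integral_tuple_prob _ (h := fun a => h (tnth r a)))//; last first.
  by move=> a x; case/andP: (h01 (tnth r a) x).
rewrite -prodEFin; apply: eq_bigr => a _.
rewrite integral_uniform; last 2 first.
- exact/measurable_EFinP.
- by move=> x; rewrite lee_fin; case/andP: (h01 (tnth r a) x).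
rewrite subr0 invr1 mul1e /average /Rintegral fineK; last first.
  by apply: integrable_fin_num; [exact: measurable_I01|exact: Fc_integrable].
by apply: eq_integral => x xI; rewrite /h patchE xI.
Qed.

End functionals_on_simplex.

(** * Convexity of x log x and the entropy *)

Section entropy_convexity.
Context {R : realType}.

(** The left-hand side is the tangent at [e] of the convex function x ln (x / m). It gives Jensen's
    inequality for the entropy, nonnegativity of the relative entropy (at [e = m]) and continuity of
    x ln (x / m) at 0. *)
Lemma xlnx_tangent (x e m : R) : 0 <= x -> 0 < e -> 0 < m ->
  x * (ln (e / m) + 1) - e <= x * ln (x / m).
Proof.
move=> x0 e0 m0; have [->|xn0] := eqVneq x 0; first by rewrite !mul0r; lra.
have xp : 0 < x by rewrite lt_neqAle eq_sym xn0.
have h : ln (e / x) <= e / x - 1.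
  have : -1 < e / x - 1 by have := divr_gt0 e0 xp; lra.
  by move=> /le_ln1Dx; rewrite addrC subrK.
have -> : ln (e / m) = ln (x / m) + ln (e / x).
  rewrite -lnM ?posrE ?divr_gt0//; congr ln; field.
  by rewrite !gt_eqF.
have := ler_wpM2l x0 h; rewrite mulrBr mulrCA mulfV// !mulr1 => h2.
by lra.
Qed.

Lemma xlnx_ge (x : R) : 0 <= x -> x - 1 <= x * ln x.
Proof.
by move=> x0; have := xlnx_tangent x0 ltr01 ltr01; rewrite !divr1 ln1 add0r mulr1.
Qed.

Lemma xlnx_bound (x m : R) : 0 <= x <= 1 -> 0 < m ->
  `|x * ln (x / m)| <= 1 + `|ln m|.
Proof.
move=> /andP[x0 x1] m0; have [->|xn0] := eqVneq x 0.
  by rewrite mul0r normr0 addr_ge0.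
have xp : 0 < x by rewrite lt_neqAle eq_sym xn0.
rewrite ln_div ?posrE// mulrBr; apply: le_trans (ler_normB _ _) _; apply: lerD.
  rewrite ler0_norm; first by have := xlnx_ge x0; lra.
  by rewrite mulr_ge0_le0// ln_le0.
by rewrite normrM ger0_norm// ler_piMl.
Qed.

End entropy_convexity.

Section entropy_simplex.
Context {R : realType} {c : nat}.
Variable mu : probability (color c) R.
Hypothesis mu_gt0 : forall r : color c, (0 < mu [set r])%E.
Implicit Types (f : color c -> R -> R) (nu : color c -> R).

Definition mass (r : color c) : R := fine (mu [set r]).

Lemma massE (r : color c) : mu [set r] = (mass r)%:E.
Proof. by rewrite fineK// fin_num_measure. Qed.

Lemma mass_gt0 r : 0 < mass r.
Proof. by rewrite -lte_fin -massE. Qed.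

Lemma sum_mass : \sum_r mass r = 1.
Proof.
have m_id (t : color c) : measurable [set r : color c | id r = t] by [].
have := measure_finite_preimage mu m_id xpredT.
rewrite (_ : [set _ | _] = setT); last by apply/seteqP; split.
move=> /(etrans (esym (probability_setT mu))) mu1.
apply: EFin_inj; rewrite -sumEFin mu1.
by apply: eq_bigr => r _; rewrite -massE.
Qed.

Lemma entropy_term_integrable f r : Fc f ->
  (@lebesgue_measure R).-integrable (`[0, 1] : set R)
    (fun u => (f r u * ln (f r u / mass r))%:E).
Proof.
move=> Ff; have [mf _ _] := Ff.
apply: (@integrable_I01 _ (fun u => f r u * ln (f r u / mass r)) (1 + `|ln (mass r)|)).
  apply: measurable_funM; first exact: mf.
  apply: measurableT_comp; first exact: measurable_ln.
  apply: measurable_funM; first exact: mf.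
  exact: measurable_cst.
by move=> u u01; apply: xlnx_bound; [exact: Fc_bound|exact: mass_gt0].
Qed.

Lemma entropyE f : Fc f -> entropy mu f =
  \sum_r \int[lebesgue_measure]_(u in `[0, 1]) (f r u * ln (f r u / mass r)).
Proof.
move=> Ff; rewrite /entropy /Rintegral; apply: EFin_inj; rewrite -sumEFin.
under [RHS]eq_bigr => r _.
  rewrite fineK; last first.
    by apply: integrable_fin_num; [exact: measurable_I01|exact: entropy_term_integrable].
  over.
rewrite -integral_sum; [|exact: measurable_I01|by move=> r; exact: entropy_term_integrable].
rewrite fineK; last first.
  apply: integrable_fin_num; first exact: measurable_I01.
  rewrite (_ : (fun _ => _) = (fun u => \sum_r (f r u * ln (f r u / mass r))%:E)%E); last first.
    by apply/funext => u; rewrite sumEFin.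
  by apply: integrable_sum; [exact: measurable_I01|move=> r _; exact: entropy_term_integrable].
by apply: eq_integral => u _; rewrite sumEFin.
Qed.

(* Jensen's inequality for x log x, integrated from its tangent at e, with e
   the average of f r, or e tending to 0 when this average vanishes. *)
Lemma entropy_ge f : Fc f -> rel_entropy mass (average f) <= entropy mu f.
Proof.
move=> Ff; rewrite entropyE//; apply: ler_sum => r _.
have [a0 _] := average_simplex Ff; have {}a0 := a0 r.
have m0 := mass_gt0 r.
have tangent e : 0 < e -> average f r * (ln (e / mass r) + 1) - e <=
    \int[lebesgue_measure]_(u in `[0, 1]) (f r u * ln (f r u / mass r)).
  move=> e0.
  have -> : average f r * (ln (e / mass r) + 1) - e =
      \int[lebesgue_measure]_(u in `[0, 1]) ((ln (e / mass r) + 1) * f r u - e).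
    rewrite RintegralB; [|exact: measurable_I01| |]; last 2 first.
    - apply: (@integrable_I01 _ (fun u => (ln (e / mass r) + 1) * f r u)
        `|ln (e / mass r) + 1|).
        by apply: measurable_funM => //; case: Ff.
      move=> u u01; have /andP[f0 f1] := Fc_bound r Ff u01.
      by rewrite normrM (ger0_norm f0) ler_piMr.
    - by apply: (@integrable_I01 _ (fun u => e) `|e|).
    rewrite RintegralZl; [|exact: measurable_I01|exact: Fc_integrable].
    by rewrite Rintegral_I01_cst mulrC.
  apply: le_Rintegral; first exact: measurable_I01.
  - apply: (@integrable_I01 _ (fun u => (ln (e / mass r) + 1) * f r u - e)
      (`|ln (e / mass r) + 1| + `|e|)).
      apply: measurable_funB => //.
      by apply: measurable_funM => //; case: Ff.
    move=> u u01; have /andP[f0 f1] := Fc_bound r Ff u01.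
    apply: le_trans (ler_normB _ _) _; apply: lerD => //.
    by rewrite normrM (ger0_norm f0) ler_piMr.
  - exact: entropy_term_integrable.
  - move=> u u01; have /andP[f0 f1] := Fc_bound r Ff u01.
    by rewrite mulrC; exact: xlnx_tangent.
have [a00|ap] := eqVneq (average f r) 0; last first.
  have a_gt0 : 0 < average f r by rewrite lt_neqAle eq_sym ap.
  by apply: le_trans (tangent _ a_gt0); rewrite mulrDr mulr1 addrK.
rewrite a00 mul0r; apply/ler_addgt0Pl => e e0.
have := tangent e e0; rewrite a00 mul0r sub0r => h.
by rewrite -lerBlDl sub0r.
Qed.

Lemma constant_Fc nu : in_simplex nu -> Fc (fun r (_ : R) => nu r).
Proof.
move=> [nu0 nu1]; split=> // r u _; rewrite in_itv/= nu0/= -nu1.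
by rewrite (bigD1 r)//= lerDl sumr_ge0.
Qed.

Lemma average_constant nu : average (fun r (_ : R) => nu r) = nu.
Proof. by apply/funext => r; rewrite /average Rintegral_I01_cst. Qed.

Lemma entropy_constant nu : entropy mu (fun r (_ : R) => nu r) = rel_entropy mass nu.
Proof. by rewrite /entropy Rintegral_I01_cst. Qed.

End entropy_simplex.

(** * Topology of the simplex *)

Lemma continuous_bigsum (R : realType) (T : topologicalType) (I : Type) (s : seq I)
    (F : I -> T -> R) :
  (forall i, continuous (F i)) -> continuous (fun x => \sum_(i <- s) F i x).
Proof.
move=> cF; elim: s => [|i s IH] x.
  under eq_fun do rewrite big_nil; exact: cvg_cst.
under eq_fun do rewrite big_cons; apply: cvgD; [exact: cF|exact: IH].
Qed.

Lemma continuous_bigprod (R : realType) (T : topologicalType) (I : Type) (s : seq I)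
    (F : I -> T -> R) :
  (forall i, continuous (F i)) -> continuous (fun x => \prod_(i <- s) F i x).
Proof.
move=> cF; elim: s => [|i s IH] x.
  under eq_fun do rewrite big_nil; exact: cvg_cst.
under eq_fun do rewrite big_cons; apply: cvgM; [exact: cF|exact: IH].
Qed.

Lemma continuous_scaled (R : realType) (T : topologicalType) (k : R) (F : T -> R) :
  continuous F -> continuous (fun x => k * F x).
Proof. by move=> cF x; apply: cvgMl_tmp; exact: cF. Qed.

Lemma continuous_difference (R : realType) (T : topologicalType) (F G : T -> R) :
  continuous F -> continuous G -> continuous (fun x => F x - G x).
Proof. by move=> cF cG x; apply: cvgB; [exact: cF|exact: cG]. Qed.

(* Here ln is 0 on nonpositive reals, so continuity holds on the whole line. *)
Lemma continuous_xlnx (R : realType) (m : R) : 0 < m ->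
  continuous (fun x : R => x * ln (x / m)).
Proof.
move=> m0 x; rewrite /continuous_at; have [xneg|xpos|->] := ltgtP x 0.
- have -> : ln (x / m) = 0 by rewrite ln0// pmulr_lle0 ?invr_gt0// ltW.
  rewrite mulr0; apply/cvgrPdist_le => e e0; near=> y.
  rewrite ln0 ?mulr0 ?subrr ?normr0 ?(ltW e0)// pmulr_lle0 ?invr_gt0//.
  by apply: ltW; near: y; exact: lt_nbhsl.
- apply: cvgM; first exact: cvg_id.
  apply: continuous_cvg; first by apply: continuous_ln; rewrite divr_gt0.
  by apply: cvgMr_tmp; exact: cvg_id.
rewrite mul0r; apply/cvgrPdist_le => e e0.
(* For 0 < y < m the value y ln (y / m) is nonpositive, and the tangent at [e / 2] bounds it below
   by [- (y * k) - e / 2]. *)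
pose k := `|ln (e / 2 / m) + 1| + 1.
have k0 : 0 < k by rewrite /k ltr_wpDl.
near=> y; rewrite sub0r normrN.
have ym : y < m by near: y; exact: lt_nbhsl.
have yk : y < e / 2 / k by near: y; apply: lt_nbhsl; rewrite !divr_gt0.
have [y0|y0] := leP y 0.
  by rewrite ln0 ?mulr0 ?normr0 ?(ltW e0)// pmulr_lle0 ?invr_gt0.
rewrite ler0_norm; last first.
  by rewrite mulr_ge0_le0 ?(ltW y0)// ln_le0// ler_pdivrMr// mul1r ltW.
have e20 : 0 < e / 2 by rewrite divr_gt0.
have := xlnx_tangent (ltW y0) e20 m0.
have : y * k < e / 2 by rewrite -ltr_pdivlMr.
have : - (y * k) <= y * (ln (e / 2 / m) + 1).
  rewrite -mulrN ler_wpM2l ?(ltW y0)// /k.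
  by have := ler_norm (- (ln (e / 2 / m) + 1)); rewrite normrN; lra.
lra.
Unshelve. all: by end_near. Qed.

Section simplex_topology.
Context {R : realType} {v c : nat}.
Variable m : color c -> R.
Hypotheses (m_gt0 : forall r, 0 < m r) (m_sum : \sum_r m r = 1).
Variable phi : v.-tuple (color c) -> R.

(** Points of the simplex are carried by row vectors for the sake of their topology: [rV_compact]
    makes the unit cube compact there. *)
Definition coords (M : 'rV[R]_(c.-1.+1)) (r : color c) : R := M ord0 r.

Definition simplex : set 'rV[R]_(c.-1.+1) := [set M | in_simplex (coords M)].

Lemma coords_row (nu : color c -> R) : coords (\row_r nu r) = nu.
Proof. by apply/funext => r; rewrite /coords mxE. Qed.

Lemma continuous_coord (r : color c) : continuous (coords ^~ r).
Proof. exact: coord_continuous. Qed.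

Lemma continuous_rel_entropy : continuous (fun M => rel_entropy m (coords M)).
Proof.
apply: continuous_bigsum => r M.
apply: (@continuous_comp _ _ _ (coords ^~ r) (fun x => x * ln (x / m r))).
  exact: continuous_coord.
exact: continuous_xlnx.
Qed.

Lemma continuous_mean_poly : continuous (fun M => mean_poly phi (coords M)).
Proof.
apply: continuous_bigsum => r; apply: continuous_scaled.
by apply: continuous_bigprod => a; exact: continuous_coord.
Qed.

Lemma closed_simplex : closed simplex.
Proof.
rewrite (_ : simplex = \bigcap_(r in [set: color c]) ((coords ^~ r) @^-1` [set x | 0 <= x])
    `&` (fun M => \sum_r coords M r) @^-1` [set x | x = 1]).
  apply: closedI.
    apply: closed_bigI => r _; apply: preimage_closed; last exact: closed_ge.
    by move=> M _; exact: continuous_coord.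
  apply: preimage_closed; last exact: closed_eq.
  by move=> M _; apply: continuous_bigsum => r; exact: continuous_coord.
apply/seteqP; split=> M [h1 h2]; split=> // r.
  by move=> _; exact: h1.
exact: (h1 r I).
Qed.

Lemma compact_simplex : compact simplex.
Proof.
apply: (subclosed_compact closed_simplex
  (rV_compact (fun=> @segment_compact R 0 1))) => M [M0 M1] r /=.
rewrite in_itv/= M0/= -M1 (bigD1 r)//= lerDl.
by apply: sumr_ge0 => i _; exact: M0.
Qed.

Lemma rel_entropy_ge0 nu : in_simplex nu -> 0 <= rel_entropy m nu.
Proof.
move=> [nu0 nu1]; apply: (@le_trans _ _ (\sum_r (nu r - m r))).
  by rewrite sumrB nu1 m_sum subrr.
apply: ler_sum => r _; have := xlnx_tangent (nu0 r) (m_gt0 r) (m_gt0 r).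
by rewrite divff ?gt_eqF// ln1 add0r mulr1.
Qed.

Lemma simplex_mass : simplex (\row_r m r).
Proof. by rewrite /simplex /= coords_row; split=> // r; exact: ltW. Qed.

Lemma mean_poly_near nu (e : R) : 0 < e -> exists2 d, 0 < d &
  forall nu', (forall r, `|nu' r - nu r| < d) ->
    `|mean_poly phi nu' - mean_poly phi nu| < e.
Proof.
move=> e0; have /cvgrPdist_lt/(_ e e0) := @continuous_mean_poly (\row_r nu r).
rewrite coords_row => /nbhs_ballP[d /= d0 H]; exists d => // nu' nn'.
have := H (\row_r nu' r); rewrite coords_row distrC; apply.
by split=> // i r; rewrite !mxE /ball/= distrC; exact: nn'.
Qed.

End simplex_topology.

(** * The rate function *)

Section rate_function.
Context {R : realType} {v c : nat}.
Variable mu : probability (color c) R.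
Hypothesis mu_gt0 : forall r : color c, (0 < mu [set r])%E.
Variable phi : v.-tuple (color c) -> R.

Local Notation m := (mass mu).
Local Notation J := (Jrate (fun=> 1) phi mu).

Let m0 := mass_gt0 mu_gt0.
Let m1 := sum_mass mu.

Lemma Jrate_le nu : in_simplex nu -> (J (mean_poly phi nu) <= (rel_entropy m nu)%:E)%E.
Proof.
move=> nuS; apply: ereal_inf_lbound; exists (fun r _ => nu r).
  split; first exact: constant_Fc.
  by rewrite Gfun_average ?average_constant//; exact: constant_Fc.
by rewrite entropy_constant.
Qed.

(** Averaging [f] keeps [G] and does not increase the entropy, so a lower bound on [J] need only be
    checked on the simplex. [Jrate_le] is the converse, from constant [f]. *)
Lemma Jrate_ge t (y : \bar R) :
  (forall nu, in_simplex nu -> mean_poly phi nu = t -> (y <= (rel_entropy m nu)%:E)%E) ->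
  (y <= J t)%E.
Proof.
move=> h; apply: le_ereal_inf_tmp => _ [f [Ff ft] <-].
apply: (@le_trans _ _ (rel_entropy m (average f))%:E).
  by apply: h; [exact: average_simplex|rewrite -Gfun_average].
by rewrite lee_fin; exact: entropy_ge.
Qed.

Lemma Jrate_ge0 t : (0 <= J t)%E.
Proof.
by apply: Jrate_ge => nu nuS _; rewrite lee_fin; apply: rel_entropy_ge0.
Qed.

Lemma Jrate_attained t : (J t < +oo)%E -> exists nu,
  [/\ in_simplex nu, mean_poly phi nu = t & J t = (rel_entropy m nu)%:E].
Proof.
move=> Jt; pose S := simplex `&` (fun M => mean_poly phi (coords M)) @^-1` [set x | x = t].
have S0 : S !=set0.
  apply: contrapT => /nonemptyPn S0; move: Jt; rewrite ltNge => /negP; apply.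
  apply: Jrate_ge => nu nuS nut; exfalso.
  suff : S (\row_r nu r) by rewrite S0.
  by split; rewrite /simplex/= coords_row.
have cS : compact S.
  apply: compact_closedI; first exact: compact_simplex.
  apply: preimage_closed; last exact: closed_eq.
  by move=> M _; exact: continuous_mean_poly.
have [] := @compact_EVT_min _ R (fun M => rel_entropy m (coords M)) S S0 cS.
  by apply: continuous_subspaceT; exact: continuous_rel_entropy.
move=> M /set_mem [MS Mt] Mmin; exists (coords M); split=> //.
apply/eqP; rewrite eq_le -{1}Mt Jrate_le//=; apply: Jrate_ge => nu nuS nut.
rewrite lee_fin -(coords_row nu); apply: Mmin; apply/mem_set.
by split; rewrite /simplex/= coords_row.
Qed.

(** The level set is the continuous image of a compact sublevel set of the relative entropy;
    equality of the two sets rests on the infimum being attained. *)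
Lemma Jrate_compact (a : R) : compact [set t | (J t <= a%:E)%E].
Proof.
rewrite (_ : [set _ | _] = (fun M => mean_poly phi (coords M)) @`
    (simplex `&` (fun M => rel_entropy m (coords M)) @^-1` [set x | x <= a])).
  apply: continuous_compact.
    by apply: continuous_subspaceT; exact: continuous_mean_poly.
  apply: compact_closedI; first exact: compact_simplex.
  apply: preimage_closed; last exact: closed_le.
  by move=> M _; exact: continuous_rel_entropy.
apply/seteqP; split=> [t /= Jt|_ [M [MS Ma] <-]] /=; last first.
  by apply: le_trans (Jrate_le MS) _; rewrite lee_fin.
have [nu [nuS nut Jnu]] := Jrate_attained (le_lt_trans Jt (ltry a)).
exists (\row_r nu r); last by rewrite coords_row.
split; first by rewrite /simplex/= coords_row.
by rewrite /= coords_row -lee_fin -Jnu.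
Qed.

Definition color_prob n (q : v.-tuple 'I_n -> R) (F : set R) : R :=
  \sum_(x : n.-tuple (color c) | `[< F (Nstat q phi x) >]) iid_weight m x.

Definition close_tensor n (eta : R) (q : v.-tuple 'I_n -> R) :=
  forall x : n.-tuple (color c), `|Nstat q phi x - mean_poly phi (empirical x)| <= eta.

Lemma rel_entropy_ge_near (F : set R) (eps : R) : 0 < eps -> exists2 eta, 0 < eta &
  forall nu, in_simplex nu -> (exists2 t, F t & `|mean_poly phi nu - t| <= eta) ->
    (ereal_inf (J @` closure F) - eps%:E <= (rel_entropy m nu)%:E)%E.
Proof.
move=> eps0; set a := ereal_inf _.
pose Pr (eta : R) (M : 'rV[R]_(c.-1.+1)) :=
  (forall t, F t -> eta < `|mean_poly phi (coords M) - t|) \/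
  (a - eps%:E <= (rel_entropy m (coords M))%:E)%E.
have cov := (compact_near_coveringP (@simplex R c)).1 (@compact_simplex R c).
have step : forall x, simplex x -> \forall x' \near x & i \near 0^'+, Pr i x'.
  move=> M MS; have [cl|ncl] := pselect (closure F (mean_poly phi (coords M))).
    have aM : (a <= (rel_entropy m (coords M))%:E)%E.
      by apply: le_trans (Jrate_le MS); apply: ereal_inf_lbound; exists (mean_poly phi (coords M)).
    have /cvgrPdist_lt/(_ eps eps0) nM := @continuous_rel_entropy R c m m0 M.
    exists ([set M' | `|rel_entropy m (coords M) - rel_entropy m (coords M')| < eps], setT).
      by split; [exact: nM|exact: filterT].
    move=> [M' i] /= [MM' _]; right.
    apply: (@le_trans _ _ (rel_entropy m (coords M) - eps)%:E).
      by rewrite EFinB leeD2r.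
    rewrite lee_fin lerBlDr -lerBlDl; apply: ltW.
    exact: le_lt_trans (ler_norm _) MM'.
  have [e /= e0 eF] : exists2 e : R, 0 < e &
      ball (mean_poly phi (coords M)) e `&` F = set0.
    move: ncl; rewrite /closure /= => /existsNP[B /not_implyP[/nbhs_ballP[e e0 eB] BF]].
    exists e => //; apply/seteqP; split=> // t [te tF]; apply: BF; exists t; split=> //.
    exact: eB.
  have e20 : 0 < e / 2 by rewrite divr_gt0.
  have /cvgrPdist_lt/(_ (e / 2) e20) nM := @continuous_mean_poly R v c phi M.
  exists ([set M' | `|mean_poly phi (coords M) - mean_poly phi (coords M')| < e / 2],
      [set i | i < e / 2]).
    by split; [exact: nM|exact: nbhs_right_lt].
  move=> [M' i] /= [MM' ie]; left=> t Ft.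
  have tM : e <= `|mean_poly phi (coords M) - t|.
    rewrite leNgt; apply/negP => h.
    have : (ball (mean_poly phi (coords M)) e `&` F) t by split.
    by rewrite eF.
  have := ler_distD (mean_poly phi (coords M')) (mean_poly phi (coords M)) t.
  by lra.
have H : \forall eta \near 0^'+, simplex `<=` Pr eta by exact: cov.
have pf : ProperFilter (0 : R)^'+ by exact: at_right_proper_filter.
have [eta [H' eta0]] := @filter_ex _ _ pf _ (filterI H (nbhs_right_gt (0 : R))).
exists eta => // nu nuS [t Ft tnu].
have : simplex (\row_r nu r) by rewrite /simplex/= coords_row.
move=> /H'; rewrite /Pr coords_row => -[/(_ t Ft)|//].
by rewrite ltNge tnu.
Qed.

End rate_function.

(** * Large deviation bounds *)

Lemma log_poly_negligible (R : realType) (k : nat) (eps : R) : 0 < eps ->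
  \forall n \near \oo, (n.+1)%:R ^+ k <= expR (n%:R * eps).
Proof.
move=> eps0.
near=> n.
have n0 : 0 < (n%:R : R) by rewrite ltr0n; near: n; exact: nbhs_infty_gt.
have le1 : k.+1`!%:R * 2 ^+ k / eps ^+ k.+1 <= n%:R by near: n; exact: nbhs_infty_ger.
have ne0 : 0 < n%:R * eps by rewrite mulr_gt0.
apply: (@le_trans _ _ ((n%:R * eps) ^+ k.+1 / k.+1`!%:R)); last first.
  have := expR_ge1Dxn k (ltW ne0); lra.
rewrite ler_pdivlMr ?ltr0n ?fact_gt0// exprMn.
apply: (@le_trans _ _ ((2 * n%:R) ^+ k * k.+1`!%:R)).
  rewrite ler_wpM2r//; apply: lerXn2r; rewrite ?nnegrE ?mulr_ge0 ?(ltW n0)//.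
  rewrite -natr1; have : 1 <= (n%:R : R) by rewrite ler1n -(ltr_nat R).
  by lra.
have {}le1 : k.+1`!%:R * 2 ^+ k <= n%:R * eps ^+ k.+1.
  by move: le1; rewrite ler_pdivrMr ?exprn_gt0.
have nk0 : 0 <= (n%:R : R) ^+ k by rewrite exprn_ge0// ltW.
have := ler_wpM2l nk0 le1; congr (_ <= _); first by rewrite exprMn; ring.
by rewrite [n%:R ^+ k.+1]exprS; ring.
Unshelve. all: by end_near. Qed.

Section large_deviations.
Context {R : realType} {v c : nat}.
Variable mu : probability (color c) R.
Hypothesis mu_gt0 : forall r : color c, (0 < mu [set r])%E.
Variable phi : v.-tuple (color c) -> R.

Local Notation m := (mass mu).
Local Notation J := (Jrate (fun=> 1) phi mu).

Let m0 : forall r, 0 < m r := mass_gt0 mu_gt0.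
Let m1 := sum_mass mu.

(** Uniformity in [q] is the point: the threshold on [n] is chosen before the tensor, so closeness
    of the random tensor is all that has to hold with high probability. *)
Lemma color_prob_upper (F : set R) (eps : R) : 0 < eps -> exists2 eta, 0 < eta &
  \forall n \near \oo, forall q : v.-tuple 'I_n -> R, close_tensor phi eta q ->
    ((n%:R^-1)%:E * lne (color_prob mu phi q F)%:E <=
      - ereal_inf (J @` closure F) + eps%:E)%E.
Proof.
move=> eps0; have eps20 : 0 < eps / 2 by rewrite divr_gt0.
have [eta eta0 far] := rel_entropy_ge_near mu_gt0 phi F eps20.
exists eta => //; set a := ereal_inf _ in far *.
near=> n => q qclose.
have n0 : (0 < n)%N by near: n; exact: nbhs_infty_gt.
have nR0 : 0 < (n%:R : R) by rewrite ltr0n.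
have w0 (x : n.-tuple (color c)) : 0 <= iid_weight m x.
  by apply: iid_weight_ge0 => r; exact: ltW.
have [P0|P0] := eqVneq (color_prob mu phi q F) 0.
  by rewrite P0 le0_lneNy// mulrNy gtr0_sg ?invr_gt0// mul1e leNye.
have Pgt0 : 0 < color_prob mu phi q F.
  by rewrite lt_neqAle eq_sym P0/= sumr_ge0.
have bound (x : n.-tuple (color c)) : F (Nstat q phi x) ->
    (a - (eps / 2)%:E <= (rel_entropy m (empirical x))%:E)%E.
  move=> Fx; apply: far; first exact: empirical_simplex.
  by exists (Nstat q phi x) => //; rewrite distrC.
have a0 : (0 <= a)%E.
  by apply: le_ereal_inf_tmp => _ [t _ <-]; exact: Jrate_ge0.
have [x0 Fx0] : exists x : n.-tuple (color c), F (Nstat q phi x).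
  apply: contrapT => /forallNP nF; move/eqP: P0; apply.
  by rewrite /color_prob big_pred0// => x; apply/asboolP; exact: nF.
have afin : a \is a fin_num.
  rewrite ge0_fin_numE//; have := bound x0 Fx0; rewrite leeBlDr//.
  by move=> /le_lt_trans; apply; rewrite -EFinD ltry.
move: afin bound => /fineK <- bound; rewrite lne_EFin// -EFinM -EFinN -EFinD lee_fin.
set b := fine a in bound *.
have {}bound (x : n.-tuple (color c)) : F (Nstat q phi x) ->
    b - eps / 2 <= rel_entropy m (empirical x).
  by move=> /bound; rewrite -EFinB lee_fin.
rewrite ler_pdivrMl// -ler_expR lnK ?posrE//.
rewrite /color_prob big_mkcond/=.
rewrite (eq_bigr (fun x => iid_weight m x * (`[< F (Nstat q phi x) >])%:R)); last first.
  by move=> x _; case: asboolP => _; rewrite ?mulr1 ?mulr0.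
apply: le_trans (@sum_by_type _ _ m n _ (expR (- (n%:R * (b - eps / 2)))) n0 m0 (expR_ge0 _) _) _.
  move=> x; case: asboolP => [Fx|_]; last by rewrite mul0r expR_ge0.
  by rewrite mul1r ler_expR lerN2 ler_wpM2l ?(ltW nR0)// bound.
have -> : n%:R * (- b + eps) = n%:R * (eps / 2) - n%:R * (b - eps / 2) by field.
rewrite expRD ler_wpM2r ?expR_ge0//.
by near: n; exact: log_poly_negligible.
Unshelve. all: by end_near. Qed.

Lemma color_prob_lower (F : set R) (eps : R) : 0 < eps -> exists2 eta, 0 < eta &
  \forall n \near \oo, forall q : v.-tuple 'I_n -> R, close_tensor phi eta q ->
    (- ereal_inf (J @` F°) - eps%:E <=
      (n%:R^-1)%:E * lne (color_prob mu phi q F)%:E)%E.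
Proof.
move=> eps0; have eps20 : 0 < eps / 2 by rewrite divr_gt0.
set a := ereal_inf _.
have a0 : (0 <= a)%E.
  by apply: le_ereal_inf_tmp => _ [t _ <-]; exact: Jrate_ge0.
have [aoo|afin] : a = +oo%E \/ a \is a fin_num.
  by move: a0; case: a => [r| |]//; [right|left].
  exists 1 => //; apply: nearW => n q _; by rewrite aoo/= leNye.
have [_ [t Ft <-] Jt] := lb_ereal_inf_adherent eps20 afin.
have [nu [nuS nut Jnu]] := Jrate_attained mu_gt0 (lt_le_trans Jt (leey _)).
move: Jt; rewrite Jnu -/a -(fineK afin) -EFinD lte_fin => KL.
have [e /= e0 eF] := (nbhs_ballP _ _).1 Ft.
have e20 : 0 < e / 2 by rewrite divr_gt0.
have [dl dl0 near_nu] := mean_poly_near phi nu e20.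
(* Half of the radius [e] pays for the statistic against the polynomial at the empirical measure,
   the other half for the empirical measure against [nu]. *)
exists (e / 2) => //.
pose et := Num.min dl (eps / 2).
have et0 : 0 < et by rewrite lt_min dl0 eps20.
near=> n => q qclose.
have nR0 : 0 < (n%:R : R) by rewrite ltr0n; near: n; exact: nbhs_infty_gt.
have w0 (x : n.-tuple (color c)) : 0 <= iid_weight m x.
  by apply: iid_weight_ge0 => r; exact: ltW.
have Ple : expR (- (n%:R * (rel_entropy m nu + et))) <= color_prob mu phi q F.
  apply: (@le_trans _ _ (\sum_(x : n.-tuple (color c) |
      [forall r, `|empirical x r - nu r| < et]) iid_weight m x)).
    by near: n; exact: type_lower_bound.
  rewrite [leLHS]big_mkcond [leRHS]big_mkcond/=; apply: ler_sum => x _.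
  case: ifPn => [/forallP xe|_]; last by case: ifP.
  rewrite ifT//; apply/asboolP; apply: eF; rewrite /ball/= -nut distrC.
  apply: le_lt_trans (ler_distD (mean_poly phi (empirical x)) _ _) _.
  rewrite [e]splitr; apply: ler_ltD; first exact: qclose.
  by apply: near_nu => r; apply: lt_le_trans (xe r) _; rewrite ge_min lexx.
have P0 : 0 < color_prob mu phi q F by apply: lt_le_trans Ple; exact: expR_gt0.
rewrite ifF; last by apply/negbTE; rewrite -ltNge.
rewrite -EFinM -EFinD lee_fin ler_pdivlMl//.
rewrite -ler_expR lnK ?posrE//; apply: le_trans Ple; rewrite ler_expR -mulrN.
rewrite ler_wpM2l ?(ltW nR0)//.
have : et <= eps / 2 by rewrite ge_min lexx orbT.
by lra.
Unshelve. all: by end_near. Qed.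

End large_deviations.

(** * Free energy *)

Section free_energy.
Context {R : realType} {v c : nat}.
Variable mu : probability (color c) R.
Hypothesis mu_gt0 : forall r : color c, (0 < mu [set r])%E.
Variable phi : v.-tuple (color c) -> R.

Local Notation m := (mass mu).

Let m0 : forall r, 0 < m r := mass_gt0 mu_gt0.
Let m1 := sum_mass mu.

Lemma tuple_prob_point n (x : n.-tuple (color c)) :
  measurable [set x] /\ tuple_prob mu n [set x] = (iid_weight m x)%:E.
Proof.
have -> : [set x] = [set t : n.-tuple (color c) | forall i, [set tnth x i] (tnth t i)].
  apply/seteqP; split=> t /=; first by move=> ->.
  by move=> h; apply: eq_from_tnth => i; exact: h.
split; last first.
  rewrite (tuple_probE mu (A := fun i => [set tnth x i])); last by [].
  by rewrite -prodEFin; apply: eq_bigr => i _; rewrite -massE.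
rewrite (_ : [set t | _] = \bigcap_(i in [set: 'I_n])
  ((fun t : n.-tuple (color c) => tnth t i) @^-1` [set tnth x i])).
  apply: fin_bigcap_measurable => [|i _]; first exact: finite_finset.
  rewrite -[X in measurable X]setTI; exact: measurable_tnth.
by apply/seteqP; split=> t /= h i => [_|]; apply: h.
Qed.

Lemma tuple_prob_expectation n (h : n.-tuple (color c) -> R) : (forall x, 0 <= h x) ->
  fine ('E_(tuple_prob mu n)[h]) = \sum_x iid_weight m x * h x.
Proof.
move=> h0; rewrite expectation.unlock.
have mpt (x : n.-tuple (color c)) : measurable [set t | id t = x].
  by have [] := tuple_prob_point x.
rewrite (eq_integral (fun t => \sum_(x : n.-tuple (color c))
    (h x)%:E * (\1_[set x] t)%:E)%E); last first.
  move=> t _; rewrite (bigD1 t)//= indicE mem_set// mule1 big1 ?adde0// => x xt.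
  by rewrite indicE memNset ?mule0//= => tx; rewrite tx eqxx in xt.
rewrite ge0_integral_sum//; last 2 first.
- move=> x; apply: emeasurable_funM => //; apply/measurable_EFinP.
  by apply: measurable_indic; have [] := tuple_prob_point x.
- by move=> x t _; rewrite mule_ge0// lee_fin.
rewrite (eq_bigr (fun x => (iid_weight m x * h x)%:E)); first by rewrite sumEFin.
move=> x _; have [mx px] := tuple_prob_point x.
rewrite ge0_integralZl//; last 2 first.
- by apply/measurable_EFinP; exact: measurable_indic.
- by rewrite lee_fin.
rewrite integral_indic// setIT -[X in (_ * X)%E]/(tuple_prob mu n [set x]) px.
by rewrite -EFinM mulrC.
Qed.

Lemma free_energy_attained (beta : R) : exists2 nu, in_simplex nu &
  forall nu', in_simplex nu' -> beta * mean_poly phi nu' - rel_entropy m nu' <=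
    beta * mean_poly phi nu - rel_entropy m nu.
Proof.
have := @compact_EVT_max _ R (fun M => beta * mean_poly phi (coords M) -
  rel_entropy m (coords M)) (@simplex R c).
move=> /(_ _ (@compact_simplex R c))[]; first by exists (\row_r m r); exact: simplex_mass.
  apply: continuous_subspaceT; apply: continuous_difference.
    by apply: continuous_scaled; exact: continuous_mean_poly.
  exact: continuous_rel_entropy.
move=> M /set_mem MS Mmax; exists (coords M) => // nu nuS.
rewrite -(coords_row nu); apply: Mmax; apply/mem_set.
by rewrite /simplex/= coords_row.
Qed.

Lemma Zlimit_simplex (beta : R) nu : in_simplex nu ->
  (forall nu', in_simplex nu' -> beta * mean_poly phi nu' - rel_entropy m nu' <=
    beta * mean_poly phi nu - rel_entropy m nu) ->
  Zlimit (fun=> 1) phi mu beta = (beta * mean_poly phi nu - rel_entropy m nu)%:E /\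
  exists2 f, Fc f & (Zobjective (fun=> 1) phi mu beta f)%:E =
     Zlimit (fun=> 1) phi mu beta.
Proof.
move=> nuS numax.
have ZE : (Zobjective (fun=> 1) phi mu beta (fun r _ => nu r)) =
    beta * mean_poly phi nu - rel_entropy m nu.
  rewrite /Zobjective Gfun_average; last exact: constant_Fc.
  by rewrite average_constant entropy_constant.
suff -> : Zlimit (fun=> 1) phi mu beta = (beta * mean_poly phi nu - rel_entropy m nu)%:E.
  by split=> //; exists (fun r _ => nu r); [exact: constant_Fc|rewrite ZE].
apply/eqP; rewrite eq_le; apply/andP; split.
  apply: ge_ereal_sup => _ [f Ff <-]; rewrite lee_fin /Zobjective Gfun_average//.
  apply: le_trans (numax _ (average_simplex Ff)).
  by rewrite lerD2l lerN2 entropy_ge.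
apply: ereal_sup_ubound; exists (fun r _ => nu r); first exact: constant_Fc.
by rewrite ZE.
Qed.

(** Laplace's principle: the upper bound is [sum_by_type] with the exponential as [h], whose
    exponent after tilting is at most the maximum; the lower bound keeps only the colourings of type
    near the maximiser [nu]. *)
Lemma Zpart_close (beta eps : R) nu : 0 < eps -> in_simplex nu ->
  (forall nu', in_simplex nu' -> beta * mean_poly phi nu' - rel_entropy m nu' <=
    beta * mean_poly phi nu - rel_entropy m nu) ->
  exists2 eta, 0 < eta &
  \forall n \near \oo, forall q : v.-tuple 'I_n -> R, close_tensor phi eta q ->
    `|Zpart q phi beta mu - (beta * mean_poly phi nu - rel_entropy m nu)| <= eps.
Proof.
move=> eps0 nuS numax; set Z := beta * mean_poly phi nu - rel_entropy m nu.
pose b := `|beta| + 1; have b0 : 0 < b by rewrite /b ltr_wpDl.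
have bbeta : `|beta| <= b by rewrite /b lerDl.
(* The lower bound uses [eta] twice, for the tensor and for the type, and spends the remaining
   [eps / 2] on [et]; adding 1 in [b] allows [beta = 0]. *)
pose eta := eps / 4 / b; have eta0 : 0 < eta by rewrite !divr_gt0.
have etab : b * eta = eps / 4 by rewrite /eta mulrC divfK ?gt_eqF.
have [dl dl0 near_nu] := mean_poly_near phi nu eta0.
pose et := Num.min dl (eps / 2).
have et0 : 0 < et by rewrite lt_min dl0 divr_gt0.
have eps20 : 0 < eps / 2 by rewrite divr_gt0.
have betaM x y : `|x - y| <= eta -> beta * x - beta * y <= eps / 4.
  move=> xy; rewrite -mulrBr -etab; apply: le_trans (ler_norm _) _.
  by rewrite normrM ler_pM.
exists eta => //.
near=> n => q qclose.
have n0 : (0 < n)%N by near: n; exact: nbhs_infty_gt.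
have nR0 : 0 < (n%:R : R) by rewrite ltr0n.
have w0 (x : n.-tuple (color c)) : 0 <= iid_weight m x.
  by apply: iid_weight_ge0 => r; exact: ltW.
rewrite /Zpart tuple_prob_expectation; last by move=> x; exact: expR_ge0.
set E := \sum_x _.
have Eup : E <= expR (n%:R * (Z + eps)).
  apply: le_trans (@sum_by_type _ _ m n _ (expR (n%:R * (Z + eps / 2))) n0 m0 (expR_ge0 _) _) _.
    move=> x; rewrite -expRD ler_expR -mulrA -mulrBr ler_wpM2l ?(ltW nR0)//.
    have := numax _ (empirical_simplex x n0); have := betaM _ _ (qclose x).
    by rewrite -/Z; lra.
  have -> : n%:R * (Z + eps) = n%:R * (eps / 2) + n%:R * (Z + eps / 2) by field.
  rewrite expRD ler_wpM2r ?expR_ge0//.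
  by near: n; exact: log_poly_negligible.
have Elow : expR (n%:R * (Z - eps)) <= E.
  apply: (@le_trans _ _ (\sum_(x : n.-tuple (color c) |
      [forall r, `|empirical x r - nu r| < et])
      expR (n%:R * (beta * mean_poly phi nu - eps / 2)) * iid_weight m x)).
    rewrite -mulr_sumr; apply: (@le_trans _ _ (expR (n%:R * (beta * mean_poly phi nu - eps / 2)) *
        expR (- (n%:R * (rel_entropy m nu + et))))); last first.
      rewrite ler_wpM2l ?expR_ge0//.
      by near: n; exact: type_lower_bound.
    rewrite -expRD ler_expR -mulrBr ler_wpM2l ?(ltW nR0)//.
    have : et <= eps / 2 by rewrite ge_min lexx orbT.
    by rewrite /Z; lra.
  rewrite [leLHS]big_mkcond/=; apply: ler_sum => x _.
  case: ifPn => [/forallP xe|_]; last by rewrite mulr_ge0 ?expR_ge0.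
  rewrite mulrC ler_wpM2l// ler_expR -mulrA ler_wpM2l ?(ltW nR0)//.
  have close1 : `|mean_poly phi nu - mean_poly phi (empirical x)| <= eta.
    rewrite distrC; apply/ltW/near_nu => r.
    by apply: lt_le_trans (xe r) _; rewrite ge_min lexx.
  have close2 : `|mean_poly phi (empirical x) - Nstat q phi x| <= eta.
    by rewrite distrC; exact: qclose.
  by have := betaM _ _ close1; have := betaM _ _ close2; lra.
have E0 : 0 < E by apply: lt_le_trans Elow; exact: expR_gt0.
rewrite ler_norml lerBrDr lerBlDr; apply/andP; split.
  rewrite ler_pdivlMl// -ler_expR lnK ?posrE//; apply: le_trans Elow.
  by rewrite ler_expR ler_wpM2l ?(ltW nR0)//; lra.
rewrite ler_pdivrMl// -ler_expR lnK ?posrE//; apply: le_trans Eup _.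
by rewrite ler_expR ler_wpM2l ?(ltW nR0)//; lra.
Unshelve. all: by end_near. Qed.

End free_energy.

(** * Conditional probabilities *)

Section coloring_law.
Context d (Omega : measurableType d) (R : realType) (P : probability Omega R).
Context {c v : nat}.
Variable mu : probability (color c) R.
Variables (n : nat) (X : 'I_n -> {RV P >-> color c}).
Hypothesis X_law : forall i B, distribution P (X i) B = mu B.
Hypothesis X_ind : mutually_independent P [set: 'I_n]%SET X.

Let coloring w : n.-tuple (color c) := [tuple X i w | i < n].

Lemma coloring_event (x : n.-tuple (color c)) :
  [set w | coloring w = x] =
  \bigcap_(i in [set` [set: 'I_n]%SET]) X i @^-1` [set tnth x i].
Proof.
apply/seteqP; split=> [w <- i _|w h]; first by rewrite /= tnth_mktuple.
by apply: eq_from_tnth => i; rewrite tnth_mktuple; apply: h; rewrite /= inE.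
Qed.

Lemma measurable_coloring (x : n.-tuple (color c)) :
  measurable [set w | coloring w = x].
Proof.
rewrite coloring_event; apply: fin_bigcap_measurable => [|i _].
  exact: finite_finset.
by rewrite -[X in measurable X]setTI; exact: measurable_funP.
Qed.

Lemma coloring_prob (B : pred (n.-tuple (color c))) :
  P [set w | B (coloring w)] = (\sum_(x | B x) iid_weight (mass mu) x)%:E.
Proof.
rewrite (measure_finite_preimage P measurable_coloring) -sumEFin.
apply: eq_bigr => x _; rewrite coloring_event.
apply: etrans (@X_ind [set: 'I_n]%SET (fun i => [set tnth x i]) (fintype.subxx _) (fun=> I)) _.
rewrite -prodEFin (eq_bigl xpredT) => [|i]; last by rewrite inE.
apply: eq_bigr => i _; rewrite -massE.
exact: X_law.
Qed.

End coloring_law.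

Section conditional_probability.
Context d (Omega : measurableType d) (R : realType) (P : probability Omega R).
Context {c v : nat}.
Variables (mu : probability (color c) R) (phi : v.-tuple (color c) -> R).
Variables (n : nat) (p : R) (H : rel 'I_v).
Variables (X : 'I_n -> {RV P >-> color c}) (G : 'I_n -> 'I_n -> {RV P >-> bool}).
Hypothesis p01 : 0 <= p <= 1.
Hypothesis G_er : erdos_renyi p G.
Hypothesis X_law : forall i B, distribution P (X i) B = mu B.
Hypothesis X_ind : mutually_independent P [set: 'I_n]%SET X.
Hypothesis XG_ind : independent_finite P
  (fun w => [tuple X i w | i < n]) (fun w i j => G i j w).

Let Q w := sym_tensor H p (fun i j => G i j w).
Let N w := Nstat (Q w) phi [tuple X i w | i < n].
Let tens g := sym_tensor H p (@graph_of n g).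

Lemma sym_tensor_code w : Q w = tens (graph_code G w).
Proof.
rewrite /Q /tens (_ : (fun i j => G i j w) = graph_of (graph_code G w))//.
by apply/funext => i; apply/funext => j; rewrite (graph_codeE G_er).
Qed.

(** On the event that the tensor equals [Q w] the statistic may be computed with [Q w] frozen, and
    independence then splits the numerator. The weight condition makes the denominator positive, so
    that the total division is a genuine one. *)
Lemma cond_prob_color (F : set R) w :
  bern_weight (pair_prob p) (graph_code G w) != 0 ->
  cond_prob P (N @^-1` F) Q w = color_prob mu phi (Q w) F.
Proof.
move=> wt; rewrite /cond_prob.
have -> : N @^-1` F `&` [set w' | Q w' = Q w] =
    (fun w' => [tuple X i w' | i < n]) @^-1` [set x | F (Nstat (Q w) phi x)] `&`
    (fun w' i j => G i j w') @^-1` [set g | sym_tensor H p g = Q w].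
  apply/seteqP; split=> w' [/= Fw Qw]; split=> //=; move: Fw.
    by rewrite /N (_ : Q w' = Q w).
  by rewrite /N (_ : Q w' = Q w).
rewrite XG_ind.
have -> : (fun w' i j => G i j w') @^-1` [set g | sym_tensor H p g = Q w] =
    [set w' | Q w' = Q w] by [].
have -> : [set w' | Q w' = Q w] = [set w' | `[< tens (graph_code G w') = Q w >]].
  by apply/seteqP; split=> w' /=; rewrite (sym_tensor_code w') => /asboolP.
rewrite (graph_event_prob p01 G_er (fun g => `[< tens g = Q w >])).
have -> : (fun w' => [tuple X i w' | i < n]) @^-1` [set x | F (Nstat (Q w) phi x)] =
    [set w' | `[< F (Nstat (Q w) phi [tuple X i w' | i < n]) >]].
  by apply/seteqP; split=> w' /= /asboolP.
rewrite (coloring_prob X_law X_ind (fun x => `[< F (Nstat (Q w) phi x) >])).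
rewrite -EFinM/= mulfK//.
apply: lt0r_neq0; apply: (@lt_le_trans _ _ (bern_weight (pair_prob p) (graph_code G w))).
  rewrite lt_neqAle eq_sym wt bern_weight_ge0//; exact: pair_prob01.
rewrite /bern_mean (bigD1 (graph_code G w))//=.
rewrite asboolT ?mulr1; last by rewrite -sym_tensor_code.
rewrite lerDl sumr_ge0// => g _; rewrite mulr_ge0// bern_weight_ge0//.
exact: pair_prob01.
Qed.

End conditional_probability.

(** * Transfer to the given probability spaces *)

Lemma cvg_EFin_dist (R : realType) (u : nat -> \bar R) (r : nat -> R) (l : R) :
  (forall n, u n = (r n)%:E) ->
  (forall eps, 0 < eps -> \forall n \near \oo, `|l - r n| <= eps) ->
  u @ \oo --> l%:E.
Proof.
move=> ur rl; rewrite (_ : u = EFin \o r); last by apply/funext.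
by apply: cvg_EFin; [exact: nearW|apply/cvgrPdist_le].
Qed.

Lemma close_of_not_far (R : realType) (v c n : nat) (H : rel 'I_v) (p eta : R)
    (phi : v.-tuple (color c) -> R) (g : {ffun 'I_n * 'I_n -> bool}) :
  ~~ far H p eta phi g -> close_tensor phi eta (sym_tensor H p (graph_of g)).
Proof. by rewrite negbK => /forallP. Qed.

Theorem proposition2p6 (R : realType)
    (c : nat) (c_ge2 : (2 <= c)%N)
    (mu : probability (color c) R)
    (mu_gt0 : forall r : color c, (0 < mu [set r])%E)
    (v : nat) (v_ge2 : (2 <= v)%N)
    (H : rel 'I_v) (H_simple : simple_graph H)
    (H_connected : connected_graph H) (H_not_tree : ~ is_tree H)
    (phi : v.-tuple (color c) -> R)
    (p : nat -> R) (p01 : forall n, 0 <= p n <= 1)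
    (p_lower : much_less
       (fun n => (n%:R * ln n%:R) `^ (- (two_core_max_degree H)%:R^-1)) p)
    (p_upper : much_less p (fun _ => 1))
    (d : nat -> measure_display) (Omega : forall n, measurableType (d n))
    (P : forall n, probability (Omega n) R)
    (G : forall n, 'I_n -> 'I_n -> {RV (P n) >-> bool})
    (G_er : forall n, erdos_renyi (p n) (@G n)) :
  let SymG n (w : Omega n) := sym_tensor H (p n) (fun i j => G n i j w) in
  (forall X : forall n, 'I_n -> {RV (P n) >-> color c},
     (forall n i B, distribution (P n) (X n i) B = mu B) ->
     (forall n, mutually_independent (P n) [set: 'I_n]%SET (X n)) ->
     (forall n, independent_finite (P n)
        (fun w => [tuple X n i w | i < n]) (fun w i j => G n i j w)) ->
     conditional_LDP P SymG
       (fun n w => Nstat (SymG n w) phi [tuple X n i w | i < n])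
       (Jrate (fun=> 1) phi mu))
  /\
  (forall beta : R,
     cvg_in_prob P (fun n w => Zpart (SymG n w) phi beta mu)
       (Zlimit (fun=> 1) phi mu beta)
     /\
     exists2 f, Fc f &
       (Zobjective (fun=> 1) phi mu beta f)%:E = Zlimit (fun=> 1) phi mu beta).
Proof.
move=> SymG.
have v0 : (0 < v)%N by exact: ltnW.
have q01 n : forall xy, 0 <= pair_prob (p n) (n := n) xy <= 1 := pair_prob01 (p01 n).
have SymE n w : SymG n w = sym_tensor H (p n) (graph_of (graph_code (G n) w)).
  exact: (sym_tensor_code H (G_er n)).
have conc eta eps : 0 < eta -> 0 < eps -> \forall n \near \oo,
    bern_mean (pair_prob (p n)) (fun g => (far H (p n) eta phi g (n := n))%:R) <= eps.
  move=> eta0 eps0.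
  by apply: filterS (concentration phi v0 H_simple p01 p_lower eta0 eps0) => n [].
split; last first.
  move=> beta; have [nu nuS numax] := free_energy_attained mu_gt0 phi beta.
  have [-> attained] := Zlimit_simplex mu_gt0 nuS numax; split=> // eps eps0.
  set Z := beta * _ - _ in attained *.
  pose B n (g : {ffun 'I_n * 'I_n -> bool}) : bool :=
    eps < `|Zpart (sym_tensor H (p n) (graph_of g)) phi beta mu - Z|.
  apply: (@cvg_EFin_dist _ _ (fun n => bern_mean (pair_prob (p n))
      (fun g : {ffun 'I_n * 'I_n -> bool} => (B n g)%:R))) => [n|e e0].
    rewrite -(graph_event_prob (p01 n) (G_er n) (B n)); congr (P n _).
    by apply/seteqP; split=> w /=; rewrite SymE lte_fin.
  have [eta eta0 Zclose] := Zpart_close mu_gt0 eps0 nuS numax.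
  apply: filterS2 (conc eta e eta0 e0) Zclose => n fare Zclose.
  rewrite sub0r normrN ger0_norm; last first.
    by apply: sumr_ge0 => g _; rewrite mulr_ge0// bern_weight_ge0.
  apply: le_trans fare; apply: bern_mean_le => // g; rewrite ler_nat.
  have [//|/close_of_not_far/Zclose Zg] := boolP (far H (p n) eta phi g).
    by rewrite leq_b1.
  by rewrite /B ltNge Zg.
move=> X X_law X_ind XG_ind; split.
- exact: Jrate_ge0.
- exact: Jrate_compact.
move=> F eps mF eps0.
pose good (n : nat) (x : R) : Prop :=
  (- ereal_inf (Jrate (fun=> 1%R) phi mu @` F°) - eps%:E <= (n%:R^-1)%:E * lne x%:E /\
   (n%:R^-1)%:E * lne x%:E <= - ereal_inf (Jrate (fun=> 1%R) phi mu @` closure F) + eps%:E)%E.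
(* The conditional probability rewritten as a function of the code of the graph, so that the event
   in the definition of the LDP becomes one covered by [graph_event_prob]. *)
pose cp n (g : {ffun 'I_n * 'I_n -> bool}) : R :=
  fine (P n ((fun w => Nstat (SymG n w) phi [tuple X n i w | i < n]) @^-1` F `&`
     [set w' | SymG n w' = sym_tensor H (p n) (graph_of g)])) /
  fine (P n [set w' | SymG n w' = sym_tensor H (p n) (graph_of g)]).
pose B n (g : {ffun 'I_n * 'I_n -> bool}) : bool :=
  `[< good n (cp n g) >].
apply: (@cvg_EFin_dist _ _ (fun n => bern_mean (pair_prob (p n))
    (fun g : {ffun 'I_n * 'I_n -> bool} => (B n g)%:R))) => [n|e e0].
  rewrite -(graph_event_prob (p01 n) (G_er n) (B n)); congr (P n _).
  by apply/seteqP; split=> w /=; rewrite /cond_prob SymE => /asboolP.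
have [eta1 eta10 upper] := color_prob_upper mu_gt0 phi F eps0.
have [eta2 eta20 lower] := color_prob_lower mu_gt0 phi F eps0.
pose eta := Num.min eta1 eta2.
have eta0 : 0 < eta by rewrite lt_min eta10.
near=> n.
have fare : bern_mean (pair_prob (p n))
    (fun g => (far H (p n) eta phi g (n := n))%:R) <= e.
  by near: n; exact: conc.
have uppern : forall q : v.-tuple 'I_n -> R, close_tensor phi eta1 q ->
    ((n%:R^-1)%:E * lne (color_prob mu phi q F)%:E <=
      - ereal_inf (Jrate (fun=> 1%R) phi mu @` closure F) + eps%:E)%E.
  by near: n; exact: upper.
have lowern : forall q : v.-tuple 'I_n -> R, close_tensor phi eta2 q ->
    (- ereal_inf (Jrate (fun=> 1%R) phi mu @` F°) - eps%:E <=
      (n%:R^-1)%:E * lne (color_prob mu phi q F)%:E)%E.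
  by near: n; exact: lower.
have B1 : bern_mean (pair_prob (p n)) (fun g => (B n g)%:R) <= 1.
  rewrite -[leRHS](bern_mean1 (pair_prob (p n) (n := n))); apply: bern_mean_le => // g.
  by case: (B n g); [exact: lexx|exact: ler01].
(* It remains to see that every graph of nonzero weight is far or satisfies [B]. *)
rewrite ger0_norm ?subr_ge0// lerBlDr -lerBlDl; apply: le_trans (lerB (lexx 1) fare) _.
rewrite lerBlDr -bern_meanD -[leLHS](bern_mean1 (pair_prob (p n) (n := n))).
apply: ler_sum => g _.
have [->|wt] := eqVneq (bern_weight (pair_prob (p n)) g) 0; first by rewrite !mul0r.
rewrite ler_wpM2l ?bern_weight_ge0//.
case: (boolP (far H (p n) eta phi g)) => [_|/close_of_not_far close_g].
  by rewrite lerDr.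
suff Bg : B n g by rewrite Bg lerDl.
(* A graph of nonzero weight is realised by some sample point, at which [cond_prob_color] can be
   applied. *)
have [w wg] : exists w, graph_code (G n) w = g.
  apply: contrapT => /forallNP nog; move/eqP: wt; apply.
  have := graph_code_prob (p01 n) (G_er n) g.
  rewrite (_ : [set w | _] = set0) ?measure0 => [[]//|].
  by apply/seteqP; split=> // w /= /nog.
rewrite -wg in wt close_g *.
apply/asboolP; rewrite /cp -SymE.
have := cond_prob_color phi H (p01 n) (G_er n) (X_law n) (X_ind n) (XG_ind n) F wt.
rewrite /cond_prob => ->.
rewrite -SymE in close_g.
split.
- by apply: lowern => x; apply: le_trans (close_g x) _; rewrite ge_min lexx orbT.
- by apply: uppern => x; apply: le_trans (close_g x) _; rewrite ge_min lexx.
Unshelve. all: by end_near. Qed.
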